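(* Let $q\in(0,1]$ and let $M_1',M_2',\ldots$ be independent identically distributed random variables such that $M_1'$ has the same distribution as $\max_{0\le t\le q}W(t)-\min_{0\le t\le q}W(t)$, where $W$ is a standard one-dimensional Brownian motion. Then, as $d\to\infty$, $$a_d\Big(\max_{h=1}^d M_h'-b_d\Big)$$ converges in distribution to a standard Gumbel random variable, i.e. one with distribution function $x\mapsto\exp(-\exp(-x))$, where $$a_d=\sqrt{\frac{2\log d}{q}},\qquad b_d=\sqrt{2q\log d}-\frac{\sqrt q\,(\log\log d-\log\tfrac{16}{\pi})}{2\sqrt{2\log d}} .$$ *)

(* Defs.v *)
From HB Require Import structures.
From mathcomp Require Import all_boot all_order all_algebra finmap.
From mathcomp Require Import all_classical all_reals all_analysis measurable_realfun.
Import Order.TTheory GRing.Theory Num.Def Num.Theory.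
Import numFieldNormedType.Exports.

Set Implicit Arguments.
Unset Strict Implicit.
Unset Printing Implicit Defensive.

Local Open Scope classical_set_scope.
Local Open Scope ring_scope.

Definition mutually_independent d (T : measurableType d) (R : realType)
    (P : probability T R) (X : nat -> {RV P >-> R}) : Prop :=
  forall (J : {fset nat}) (A : nat -> set R),
    (forall i, measurable (A i)) ->
    P (\bigcap_(i in [set` J]) (X i @^-1` A i)) =
    (\prod_(i <- J) distribution P (X i) (A i))%E.

Arguments mutually_independent {d T R} P X.

Definition iid d (T : measurableType d) (R : realType)
    (P : probability T R) (X : nat -> {RV P >-> R}) : Prop :=
  mutually_independent P X /\
  forall i j (A : set R), measurable A ->
    distribution P (X i) A = distribution P (X j) A.

Arguments iid {d T R} P X.

(* The process is indexed by R, but only the times t >= 0 are constrained.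
   [normal_prob m s] has mean m and standard deviation s.  Independence of the
   increments along infinite nondecreasing sequences of times amounts to the
   usual one along finite ones, since these extend by a constant. *)
Record standard_brownian_motion d (T : measurableType d) (R : realType)
    (P : probability T R) (W : R -> {RV P >-> R}) : Prop := {
  bm_start : {ae P, forall w, W 0 w = 0};
  bm_independent_increments : forall t : nat -> R,
    0 <= t 0%N -> nondecreasing_seq t ->
    mutually_independent P (fun i => W (t i.+1) \- W (t i) : {RV P >-> R});
  bm_gaussian_increments : forall s t : R, 0 <= s -> s < t ->
    forall A : set R, measurable A ->
    distribution P (W t \- W s : {RV P >-> R}) A =
    normal_prob 0 (Num.sqrt (t - s)) A;
  bm_continuous_paths : forall w,
    {within [set t | 0 <= t], continuous (fun t => W t w)} }.

Arguments standard_brownian_motion {d T R} P W.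

(* When f is continuous on [0, q] and 0 <= q, the supremum and the infimum are
   a maximum and a minimum.  Applied to the paths of a Brownian motion this is
   a measurable function of the sample point, as these paths are continuous. *)
Definition path_range (R : realType) (q : R) (f : R -> R) : R :=
  sup [set f t | t in `[0, q]] - inf [set f t | t in `[0, q]].

Section max_rv.
Context d (T : measurableType d) (R : realType) (P : probability T R).
Variable X : nat -> {RV P >-> R}.

(* The maximum of the first n variables (from X 0 on) when 0 < n; X 0 when n = 0. *)
Definition max_rv (n : nat) : T -> R :=
  fun w => \big[Num.max/X 0%N w]_(h < n) X h w.

Lemma measurable_max_rv n : measurable_fun [set: T] (max_rv n).
Proof.
rewrite /max_rv; under eq_fun do rewrite -(big_mkord xpredT (fun h => X h _)).
elim: (index_iota 0 n) => [|h r IH].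
  by under eq_fun do rewrite big_nil; exact: measurable_funPT.
under eq_fun do rewrite big_cons.
by apply: measurable_maxr => //; exact: measurable_funPT.
Qed.

HB.instance Definition _ n :=
  isMeasurableFun.Build _ _ _ _ (max_rv n) (measurable_max_rv n).

End max_rv.

(* F is meant to be the distribution function of the limit law. *)
Definition cvg_in_distribution d (T : measurableType d) (R : realType)
    (P : probability T R) (X : nat -> {RV P >-> R}) (F : R -> R) : Prop :=
  forall x : R, {for x, continuous F} ->
    cdf (X n) x @[n --> \oo] --> (F x)%:E.

Arguments cvg_in_distribution {d T R} P X F.

Definition gumbel_cdf (R : realType) (x : R) : R := expR (- expR (- x)).

(* The values at d = 0 and d = 1, where log (log d) or a division is
   degenerate, are junk; only d --> oo matters. *)
Definition scale_a (R : realType) (q : R) (d : nat) : R :=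
  Num.sqrt (2 * ln d%:R / q).

Definition shift_b (R : realType) (q : R) (d : nat) : R :=
  Num.sqrt (2 * q * ln d%:R)
  - Num.sqrt q * (ln (ln d%:R) - ln (16 / pi)) / (2 * Num.sqrt (2 * ln d%:R)).

(* Main.v *)
Require Import Defs.
From HB Require Import structures.
From mathcomp Require Import all_boot all_order all_algebra.
From mathcomp Require Import all_classical all_reals all_analysis measurable_realfun.
From mathcomp Require Import finmap ring lra.
Import Order.TTheory GRing.Theory Num.Def Num.Theory.
Import numFieldNormedType.Exports.

(** The range of a path exceeds r exactly when its drawup or its drawdown does.
    Sample Brownian motion W at the multiples of q / N.  For the resulting
    Gaussian walk S, y = S - min S and z = max S - S are reflected walks driven
    by opposite increments, and when the range first exceeds r one of them is 0
    and the other one exceeds r.  Let u_k(y) = 2 P(|y + S_k| > rho), where k is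
    the number of remaining steps: this solves the discrete heat equation, is
    even, and is nondecreasing in |y|.  Reflection at 0 can therefore only
    decrease it, and u_k(y) + u_k(z) with rho = r is a supermartingale
    dominating the indicator of {range > r}; hence
    P(range > r) <= 2 u_N(0) = 8 Phi(- r / sqrt q) for every N.  Conversely,
    u_k(y + delta) + u_k(z + delta) with rho = r + 2 delta is a submartingale,
    except when an increment is larger than delta, and it is at most
    1 + 6 Phi(- r / sqrt q) upon exit.  Letting N tend to oo (the paths are
    continuous) and then delta to 0,
    8 Phi(- r / sqrt q) / (1 + 6 Phi(- r / sqrt q))
      <= P(range > r) <= 8 Phi(- r / sqrt q).
    By Mills' ratio d P(range > b_d + x / a_d) tends to exp(- x), whence the
    Gumbel limit for the maximum of d independent copies. *)

Set Implicit Arguments.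
Unset Strict Implicit.
Unset Printing Implicit Defensive.

Local Open Scope classical_set_scope.
Local Open Scope ring_scope.

(** * The standard normal distribution function and Mills' ratio *)

Section normal_cdf.
Context {R : realType}.
Implicit Types x y s : R.

Definition Phi x : R := fine (normal_prob 0 1 `]-oo, x]).

Definition phi x : R := normal_peak 1 * expR (- x ^+ 2 / 2).

Lemma normal_pdf_phi : normal_pdf 0 1 = phi.
Proof.
by apply/funext => x; rewrite normal_pdfE ?oner_neq0// /normal_fun subr0 expr1n.
Qed.

Lemma phi_gt0 x : 0 < phi x.
Proof. by rewrite mulr_gt0 ?expR_gt0 ?normal_peak_gt0. Qed.

Lemma is_derive_Phi x : is_derive x 1 Phi (phi x).
Proof.
have [] := @continuous_FTC1 R (normal_pdf 0 1) -oo%O x (x + 1).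
- by rewrite ltrDl.
- apply: integrableS (integrable_normal_pdf 0 1) => //.
- exact: ltNyr.
- by apply: continuous_normal_pdf; rewrite oner_neq0.
move=> dF F'; apply: DeriveDef => //.
by rewrite -derive1E -normal_pdf_phi.
Qed.

Lemma continuous_Phi : continuous Phi.
Proof.
move=> x; apply/differentiable_continuous/derivable1_diffP.
by case: (is_derive_Phi x).
Qed.

Let idTR : measurableTypeR R -> R := idfun.

#[local] HB.instance Definition _ :=
  @isMeasurableFun.Build _ _ _ _ idTR (@measurable_id _ _ setT).

Lemma cvg_PhiNy : Phi x @[x --> -oo] --> (0 : R).
Proof.
apply: fine_cvg.
pose P : probability (measurableTypeR R) R := @normal_prob R 0 1.
exact: (@cvg_cdfNy0 _ _ _ P (idTR : {RV P >-> R})).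
Qed.

Lemma Phi_ge0 x : 0 <= Phi x.
Proof. by rewrite fine_ge0. Qed.

Lemma Phi_le1 x : Phi x <= 1.
Proof.
rewrite -lee_fin fineK ?fin_num_measure//; exact: probability_le1.
Qed.

Lemma Phi_nondecreasing : {homo Phi : x y / x <= y}.
Proof.
move=> x y xy; rewrite fine_le ?fin_num_measure// le_measure ?inE//.
- by apply/mem_set; exact: (measurable_itv `]-oo, x]).
- by apply/mem_set; exact: (measurable_itv `]-oo, y]).
- by move=> z /=; rewrite !in_itv/= => /le_trans; apply.
Qed.

Lemma normal_prob_tail s x : 0 < s ->
  normal_prob 0 s `]x, +oo[ = (Phi (- x / s))%:E.
Proof.
move=> s0.
rewrite /normal_prob integral_itv_obnd_cbnd; last first.
  apply/measurable_EFinP/measurable_funTS; exact: measurable_normal_pdf.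
have dF (t : R) : is_derive t 1 (fun u => - Phi (- u / s)) (normal_pdf 0 s t).
  have d1 : is_derive t 1 (fun u => - u / s) (- s^-1).
    apply: is_derive_eq.
    by rewrite scaler0 add0r scalerN /GRing.scale/= mulr1.
  have := is_deriveN
    (@is_derive1_comp R Phi (fun u => - u / s) t _ _ (is_derive_Phi (- t / s)) d1).
  move=> H; apply: (is_derive_eq H).
  rewrite normal_pdfE ?gt_eqF// /normal_fun subr0 /phi /GRing.scale/=.
  rewrite /normal_peak !mulrN opprK mulrC expr1n mul1r.
  rewrite -mulrnAr sqrtrM ?sqr_ge0// sqrtr_sqr gtr0_norm// invfM -mulrA.
  rewrite expr_div_n sqrrN -(mulr_natr (s ^+ 2)) invfM !mulNr [in RHS]mulrA.
  by rewrite mulrA expr2 !invfM !mulrA.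
rewrite (@ge0_continuous_FTC2y R _ (fun u => - Phi (- u / s)) x 0).
- by rewrite EFinN oppeK add0e.
- by move=> t _; exact: normal_pdf_ge0.
- by apply: continuous_subspaceT; apply: continuous_normal_pdf; rewrite gt_eqF.
- rewrite -oppr0; apply: cvgN.
  apply: (@cvg_comp _ _ _ (fun u => - u / s) Phi _ -oo); last exact: cvg_PhiNy.
  by apply: gt0_cvgMlNy; rewrite ?invr_gt0//; exact/cvgNrNy.
- by move=> t _; case: (dF t).
- apply: cvg_at_right_filter.
  have /derivable1_diffP/differentiable_continuous :
      derivable (fun u : R => - Phi (- u / s)) x 1.
    by case: (dF x).
  exact.
- by move=> t _; rewrite derive1E; case: (dF t).
Qed.

Lemma PhiN x : Phi (- x) = 1 - Phi x.
Proof.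
have := @normal_prob_tail 1 x ltr01; rewrite divr1 -setCitvl => H.
apply: EFin_inj; rewrite -H probability_setC// EFinB /Phi fineK//.
exact: fin_num_measure.
Qed.

Lemma normal_prob_Ny s x : 0 < s ->
  normal_prob 0 s `]-oo, x[ = (Phi (x / s))%:E.
Proof.
move=> s0; rewrite -setCitvr probability_setC; last exact: (measurable_itv `[x, +oo[).
have /= -> : (normal_prob 0 s : probability _ R) `[x, +oo[%classic =
    normal_prob 0 s `]x, +oo[.
  rewrite /normal_prob integral_itv_obnd_cbnd//.
  apply/measurable_EFinP/measurable_funTS; exact: measurable_normal_pdf.
by rewrite normal_prob_tail// mulNr PhiN EFinB oppeB// addeA subee// add0e.
Qed.

Lemma Phi0 : Phi 0 = 2^-1.
Proof. have := PhiN 0; rewrite oppr0 => H; lra. Qed.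

Lemma is_derive_phi x : is_derive x 1 phi (- x * phi x).
Proof.
rewrite /phi; apply: is_derive_eq.
rewrite /GRing.scale/=.
by rewrite !mulr1 mulr0; field.
Qed.


Lemma phi_ub x : x != 0 -> phi x <= normal_peak 1 * 8 / x ^+ 4.
Proof.
move=> x0.
have x2 : 0 < x ^+ 2 by rewrite exprn_even_gt0.
rewrite /phi -mulrA ler_pM2l ?normal_peak_gt0 ?oner_neq0//.
rewrite mulNr expRN -lef_pV2 ?posrE ?invr_gt0 ?expR_gt0//; last first.
  by rewrite divr_gt0// exprn_even_gt0.
rewrite invrK invf_div.
have := @expR_ge1Dxn R (x ^+ 2 / 2) 1 (divr_ge0 (ltW x2) (ler0n _ _)).
apply: le_trans; rewrite -[leLHS]add0r lerD// /factorial/= mul1n.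
rewrite le_eqVlt; apply/orP; left; by apply/eqP; field.
Qed.

Lemma cvg_phiy : phi x @[x --> +oo] --> (0 : R).
Proof.
apply: (@squeeze_cvgr _ _ _ _ (fun=> 0) (fun x => normal_peak 1 * 8 / x)).
- near=> x; have x0 : 1 <= x by near: x; exact: nbhs_pinfty_ge.
  rewrite ltW ?phi_gt0//=; apply: (le_trans (phi_ub _)).
    by rewrite gt_eqF// (lt_le_trans _ x0).
  rewrite ler_pM2l ?mulr_gt0 ?normal_peak_gt0 ?oner_neq0//.
  rewrite lef_pV2 ?posrE ?exprn_gt0 ?(lt_le_trans _ x0)//.
  by rewrite -[leLHS]expr1 ler_weXn2l.
- exact: cvg_cst.
- rewrite -[X in _ --> X](mulr0 (normal_peak 1 * 8)).
  apply: cvgMr; apply/gtr0_cvgV0; first exact: nbhs_pinfty_gt.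
  exact: cvg_id.
Unshelve. all: by end_near. Qed.

Lemma le0_derive_cvg0_ge0 (f g : R -> R) x :
  0 < x -> (forall t : R, 0 < t -> is_derive t 1 f (g t)) ->
  (forall t, 0 < t -> g t <= 0) ->
  f t @[t --> +oo] --> (0 : R) -> 0 <= f x.
Proof.
move=> x0 df g0 f0; apply: (cvgr_to_le f0).
near=> y; apply: (@ler0_derive1_nincry _ f x) => //.
- move=> t; rewrite in_itv/= andbT => xt.
  by case: (df t (lt_trans x0 xt)).
- move=> t; rewrite in_itv/= andbT => xt; have t0 := lt_trans x0 xt.
  by rewrite derive1E; case: (df t t0) => _ ->; exact: g0.
- apply/continuous_within_itvcyP; split.
    move=> t; rewrite in_itv/= andbT => xt; have t0 := lt_trans x0 xt.
    by apply/differentiable_continuous/derivable1_diffP; case: (df t t0).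
  apply: cvg_at_right_filter.
  by apply/differentiable_continuous/derivable1_diffP; case: (df x x0).
Unshelve. all: by end_near. Qed.

Lemma cvg_PhiN : Phi (- x) @[x --> +oo] --> (0 : R).
Proof. by move/cvgNy_compNP : cvg_PhiNy. Qed.

Lemma is_derive_PhiN x : is_derive x 1 (fun t => Phi (- t)) (- phi x).
Proof.
have -> : (fun t => Phi (- t)) = cst 1 - Phi by apply/funext => t; rewrite PhiN.
have dP := is_derive_Phi x.
by apply: is_derive_eq; rewrite sub0r.
Qed.

Lemma is_derive_Mills x : x != 0 ->
  is_derive x 1 (fun t => phi t / t) (- phi x - phi x / x ^+ 2).
Proof.
move=> x0; have dp := is_derive_phi x.
have dV := @is_deriveV R id x _ 1 x0 (is_derive_id x 1).
have := is_deriveM dp dV => H; apply: (is_derive_eq H).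
by rewrite /GRing.scale/=; field.
Qed.

Lemma Mills_ub x : 0 < x -> Phi (- x) <= phi x / x.
Proof.
move=> x0; rewrite -subr_ge0.
pose f t := phi t / t - Phi (- t).
suff : 0 <= f x by [].
apply: (@le0_derive_cvg0_ge0 f (fun t => - phi t / t ^+ 2) x x0).
- move=> t t0; have d1 := is_derive_Mills (lt0r_neq0 t0).
  have H := is_deriveB d1 (is_derive_PhiN t).
  apply: (is_derive_eq H).
  by rewrite opprK addrAC addNr add0r mulNr.
- move=> t t0; rewrite mulNr oppr_le0 divr_ge0 ?sqr_ge0//; exact/ltW/phi_gt0.
- rewrite -[X in _ --> X](subr0 0) -{1}(mulr0 0); apply: cvgB; last exact: cvg_PhiN.
  apply: cvgM; first exact: cvg_phiy.
  apply/gtr0_cvgV0; first exact: nbhs_pinfty_gt.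
  exact: cvg_id.
Qed.

Lemma Phi_tail x : 1 <= x -> Phi (- x) <= normal_peak 1 * 8 / x ^+ 4.
Proof.
move=> x1; have x0 : 0 < x by exact: lt_le_trans x1.
apply: (le_trans (Mills_ub x0)); apply: le_trans (phi_ub (lt0r_neq0 x0)).
by rewrite ler_pdivrMr// ler_peMr// ltW// phi_gt0.
Qed.

Lemma Mills_lb x : 0 < x -> phi x / x * (1 - x ^- 2) <= Phi (- x).
Proof.
move=> x0; rewrite -subr_ge0.
pose f t := Phi (- t) - phi t / t * (1 - t ^- 2).
suff : 0 <= f x by [].
apply: (@le0_derive_cvg0_ge0 f (fun t => - 3 * phi t / t ^+ 4) x x0).
- move=> t t0; have tn0 := lt0r_neq0 t0; have d1 := is_derive_Mills tn0.
  have d2 : is_derive t 1 (fun t => 1 - t ^- 2) (2 / t ^+ 3).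
    have dX : is_derive t 1 (fun t : R => t ^+ 2) (t *+ 2).
      by apply: is_derive_eq; rewrite /GRing.scale/= mulr1 mulr2n.
    have dV := @is_deriveV R (fun t => t ^+ 2) t _ 1 (expf_neq0 2 tn0) dX.
    have := is_deriveB (is_derive_cst (1 : R) t 1) dV => H.
    by apply: (is_derive_eq H); rewrite /GRing.scale/=; field.
  have := is_deriveB (is_derive_PhiN t) (is_deriveM d1 d2) => H.
  by apply: (is_derive_eq H); rewrite /GRing.scale/=; field.
- move=> t t0; rewrite !mulNr oppr_le0 divr_ge0 ?exprn_ge0 ?ltW//.
  by rewrite mulr_gt0// phi_gt0.
- rewrite -[X in _ --> X](subr0 0); apply: cvgB; first exact: cvg_PhiN.
  have Vy : (t^-1) @[t --> +oo] --> (0 : R).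
    apply/gtr0_cvgV0; first exact: nbhs_pinfty_gt.
    exact: cvg_id.
  rewrite -[X in _ --> X](_ : 0 * 0 * (1 - 0 * 0) = 0); last by ring.
  apply: cvgM; first by apply: cvgM => //; exact: cvg_phiy.
  apply: cvgB; first exact: cvg_cst.
  under eq_fun do rewrite -exprVn expr2.
  exact: cvgM.
Qed.

End normal_cdf.

(** * Markov chains driven by independent variables *)

Lemma integral_probability_cst d (T : measurableType d) (R : realType)
    (P : probability T R) (c : R) : (\int[P]_w c%:E = c%:E)%E.
Proof.
transitivity (c%:E * P [set: T])%E; first exact: integral_cst.
by rewrite probability_setT mule1.
Qed.

Section chain_independence.
Local Open Scope ereal_scope.
Context d (T : measurableType d) (R : realType) (P : probability T R).
Variable X : nat -> {RV P >-> R}.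
Hypothesis indX : mutually_independent P X.

Let later (B : nat -> set R) k n :=
  \bigcap_(i in [set i | (k <= i < n)%N]) (X i @^-1` B i).

Lemma mutually_independent_nat (B : nat -> set R) k n :
  (forall i, measurable (B i)) ->
  P (later B k n) = \prod_(k <= i < n) P (X i @^-1` B i).
Proof.
move=> mB; have := indX [fset i in index_iota k n]%fset mB.
rewrite (perm_big (index_iota k n)) /=; last first.
  apply: uniq_perm; rewrite ?fset_uniq ?iota_uniq// => i.
  by rewrite !inE.
rewrite /later (_ : [set` _] = [set i | (k <= i < n)%N]) => [-> //|].
by apply/seteqP; split => i /=; rewrite !inE mem_index_iota.
Qed.

Let measurable_later B k n : (forall i, measurable (B i)) -> measurable (later B k n).
Proof.
move=> mB; apply: bigcap_measurableType => i _; exact: measurable_funPTI.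
Qed.

Context d' (S : measurableType d') (s : nat -> {RV P >-> S}) (F : S * R -> S).
Hypothesis mF : measurable_fun [set: S * R] F.
Hypothesis s0_cst : exists x, forall w, s 0%N w = x.
Hypothesis sS : forall k w, s k.+1 w = F (s k w, X k w).

Let mZ k : measurable_fun [set: T] (fun w => (s k w, X k w)).
Proof. by apply/measurable_fun_pairP; split; exact: measurable_funPT. Qed.

Let Z k : {mfun T >-> (S * R)%type} :=
  HB.pack (fun w => (s k w, X k w)) (isMeasurableFun.Build _ _ _ _ _ (mZ k)).

Let chain_later_indep k n (A : set S) (B : nat -> set R) :
  measurable A -> (forall i, measurable (B i)) ->
  P (s k @^-1` A `&` later B k n) = P (s k @^-1` A) * P (later B k n).
Proof.
elim: k n A B => [n A B mA mB|k IH n A B mA mB].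
  have [x s0] := s0_cst.
  have [Ax|nAx] := pselect (A x).
    have -> : s 0%N @^-1` A = setT by apply/seteqP; split => w //= _; rewrite s0.
    by rewrite setTI probability_setT mul1e.
  have -> : s 0%N @^-1` A = set0 by apply/seteqP; split => w //=; rewrite s0.
  by rewrite set0I measure0 mul0e.
have [kn|nk] := ltnP k n; last first.
  have -> : later B k.+1 n = setT.
    apply/seteqP; split => w //= _ i /= /andP[ki].
    by move/(leq_ltn_trans ki); rewrite ltnNge leqW// .
  by rewrite setIT probability_setT mule1.
set E := later B k.+1 n.
have mE : measurable E by exact: measurable_later.
pose e : {nonneg R} := NngNum (fine_ge0 (measure_ge0 P E)).
pose m1' : {measure set (S * R) -> \bar R} :=
  pushforward (mrestr P mE) (Z k).
pose m1 := m1' (mZ k).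
pose m2 : {measure set (S * R) -> \bar R} := mscale e (distribution P (Z k)).
have eE : e%:num%:E = P E by rewrite /= fineK// fin_num_measure.
have rect A1 A2 : measurable A1 -> measurable A2 ->
    P (Z k @^-1` (A1 `*` A2) `&` E) = P (s k @^-1` A1) * P (X k @^-1` A2) * P E.
  move=> mA1 mA2.
  pose B' i := if i == k then A2 else B i.
  have mB' i : measurable (B' i) by rewrite /B'; case: ifP.
  have EE : E = later B' k.+1 n.
    apply: eq_bigcapr => i /= /andP[ki _].
    by rewrite /B' gtn_eqF.
  have LE : later B' k n = X k @^-1` A2 `&` E.
    rewrite EE; apply/seteqP; split => w /=.
      move=> H; split; first by have := H k; rewrite /B' eqxx/= leqnn; exact.
      by move=> i /= /andP[ki iN]; apply: H => /=; rewrite (ltnW ki).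
    move=> [w1 w2] i /= /andP[]; rewrite leq_eqVlt => /predU1P[<- _|ki iN].
      by rewrite /B' eqxx.
    by apply: w2 => /=; rewrite ki.
  transitivity (P (s k @^-1` A1 `&` later B' k n)).
    by congr (P _); rewrite LE setIA.
  rewrite IH// mutually_independent_nat// big_ltn// -mutually_independent_nat//.
  by rewrite -EE /B' eqxx muleA.
have mC : measurable (F @^-1` A) by rewrite -[X in measurable X]setTI; exact: mF.
have mu12 : m1 (F @^-1` A) = m2 (F @^-1` A).
  pose rects := [set C : set (S * R) | exists2 A1, measurable A1 &
    exists2 A2, measurable A2 & A1 `*` A2 = C].
  apply: (@measure_unique _ _ _ rects (fun=> setT)) => //.
  - by rewrite measurable_prod_measurableType.
  - move=> /= _ _ [X1 mX1 [X2 mX2 <-]] [Y1 mY1 [Y2 mY2 <-]].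
    rewrite -setXI; exists (X1 `&` Y1); first exact: measurableI.
    by exists (X2 `&` Y2) => //; exact: measurableI.
  - by move=> _; exists setT => //; exists setT => //; rewrite setXTT.
  - by apply/seteqP; split => // x _; exists 0%N.
  - move=> _ [A1 mA1 [A2 mA2 <-]].
    rewrite /= /mscale /pushforward /mrestr/=.
    rewrite [LHS]rect// fineK ?fin_num_measure// muleC; congr (_ * _).
    have := @IH k.+1 A1 (fun=> A2) mA1 (fun=> mA2).
    rewrite mutually_independent_nat// big_nat1 => <-; congr (P _).
    apply/seteqP; split=> [w [w1 w2]|w [w1 w2]] /=.
      by split => //; apply: w2; rewrite /= leqnn ltnSn.
    by split => // i; rewrite /= ltnS -eqn_leq => /eqP <-.
  - move=> _; rewrite /= /pushforward /mrestr preimage_setT setTI.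
    by rewrite -ge0_fin_numE// fin_num_measure.
have -> : s k.+1 @^-1` A = Z k @^-1` (F @^-1` A).
  by apply/seteqP; split => w /=; rewrite sS.
move: mu12; rewrite /= /mscale /pushforward /mrestr/= => ->.
by rewrite fineK ?fin_num_measure// muleC.
Qed.

Let joint k (C : set (S * R)) : measurable C ->
  distribution P (Z k) C = (distribution P (s k) \x distribution P (X k)) C.
Proof.
move=> mC; apply/esym/product_measure_unique => // A B mA mB.
pose B' (i : nat) := B.
have := @chain_later_indep k k.+1 A B' mA (fun=> mB).
have -> : later B' k k.+1 = X k @^-1` B.
  apply/seteqP; split => w /=; first by apply; rewrite /= leqnn ltnSn.
  by move=> wB i /=; rewrite ltnS -eqn_leq => /eqP <-.
by [].
Qed.

Lemma chain_integral k (f : S * R -> \bar R) :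
  measurable_fun [set: S * R] f -> (forall x, 0 <= f x) ->
  \int[P]_w f (s k w, X k w) =
  \int[P]_w \int[distribution P (X k)]_x f (s k w, x).
Proof.
move=> mf f0.
transitivity (\int[distribution P (Z k)]_z f z).
  by rewrite ge0_integral_pushforward//; exact: measurable_funPT.
transitivity (\int[distribution P (s k) \x distribution P (X k)]_z f z).
  by apply: eq_measure_integral => C mC _; exact: joint.
rewrite fubini_tonelli1// ge0_integral_pushforward//.
- exact: measurable_fun_fubini_tonelli_F.
- by move=> x _; exact: integral_ge0.
Qed.

Lemma chain_integral_swap k (f : S * R -> \bar R) :
  measurable_fun [set: S * R] f -> (forall x, 0 <= f x) ->
  \int[P]_w f (s k w, X k w) =
  \int[distribution P (X k)]_x \int[P]_w f (s k w, x).
Proof.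
move=> mf f0.
transitivity (\int[distribution P (Z k)]_z f z).
  by rewrite ge0_integral_pushforward//; exact: measurable_funPT.
transitivity (\int[distribution P (s k) \x distribution P (X k)]_z f z).
  by apply: eq_measure_integral => C mC _; exact: joint.
rewrite fubini_tonelli2//; apply: eq_integral => x _.
rewrite /fubini_G ge0_integral_pushforward//.
exact: measurable_fun_pair1.
Qed.

Let measurable_step (V : S -> \bar R) :
  measurable_fun [set: S] V -> measurable_fun [set: S * R] (V \o F).
Proof. by move=> mV; exact: measurableT_comp. Qed.

Lemma chain_supermartingale (V : nat -> S -> \bar R) n :
  (forall k, measurable_fun [set: S] (V k)) -> (forall k x, 0 <= V k x) ->
  (forall i k x, \int[distribution P (X i)]_z V k (F (x, z)) <= V k.+1 x) ->
  \int[P]_w V 0%N (s n w) <= \int[P]_w V n (s 0%N w).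
Proof.
move=> mV V0 VF.
suff H j : (j <= n)%N -> \int[P]_w V (n - j)%N (s j w) <= \int[P]_w V n (s 0%N w).
  by have := H n (leqnn n); rewrite subnn.
elim: j => [_|j IH jn]; first by rewrite subn0.
apply: (le_trans _ (IH (ltnW jn))).
under eq_integral do rewrite sS.
rewrite (@chain_integral j (V (n - j.+1)%N \o F))//; last 2 first.
- exact: (measurable_step (mV _)).
- by move=> x /=; exact: V0.
apply: ge0_le_integral => //.
- by move=> w _; apply: integral_ge0 => x _; exact: V0.
- apply: (measurableT_comp (f := fubini_F _ (V (n - j.+1)%N \o F))) => //.
  by apply: measurable_fun_fubini_tonelli_F => [|x]; [exact: measurable_step|exact: V0].
- exact: measurableT_comp.
- by move=> w _; rewrite (le_trans (VF j _ _))// -subSn// subSS.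
Qed.

Lemma chain_submartingale (V : nat -> S -> \bar R) (e : R) n : (0 <= e)%R ->
  (forall k, measurable_fun [set: S] (V k)) -> (forall k x, 0 <= V k x) ->
  (forall i k x, (k < n)%N ->
    V k.+1 x <= \int[distribution P (X i)]_z V k (F (x, z)) + e%:E) ->
  \int[P]_w V n (s 0%N w) <= \int[P]_w V 0%N (s n w) + (e *+ n)%:E.
Proof.
move=> e0 mV V0 VF.
suff H j : (j <= n)%N ->
    \int[P]_w V n (s 0%N w) <= \int[P]_w V (n - j)%N (s j w) + (e *+ j)%:E.
  by have := H n (leqnn n); rewrite subnn.
elim: j => [_|j IH jn]; first by rewrite subn0 mulr0n adde0.
apply: (le_trans (IH (ltnW jn))); rewrite mulrS EFinD addeA leeD2r//.
under [in leRHS]eq_integral do rewrite sS.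
rewrite (@chain_integral j (V (n - j.+1)%N \o F))//; last 2 first.
- exact: (measurable_step (mV _)).
- by move=> x /=; exact: V0.
set g := fun x => \int[distribution P (X j)]_z V (n - j.+1)%N (F (x, z)).
have mg : measurable_fun [set: S] g.
  apply: (@measurable_fun_fubini_tonelli_F _ _ _ _ _ _ (V (n - j.+1)%N \o F)).
    exact: measurable_step.
  by move=> x; exact: V0.
apply: (@le_trans _ _ (\int[P]_w (g (s j w) + e%:E))).
  apply: ge0_le_integral => //.
  - exact: measurableT_comp.
  - by apply: emeasurable_funD => //; exact: measurableT_comp.
  - move=> w _; have := VF j (n - j.+1)%N (s j w).
    by rewrite -subSn// subSS leq_subr; apply.
rewrite ge0_integralD//; last 2 first.
- by move=> w _; apply: integral_ge0 => x _; exact: V0.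
- exact: measurableT_comp.
by rewrite integral_probability_cst.
Qed.

End chain_independence.

(** * The range of a walk *)

Section range_chain.
Context {R : realType}.
Implicit Types (r x y : R) (s : R * R).

(* A state [s] is the pair of the drawup and the drawdown at the current time, so
   that [s.1 + s.2] is the current range; the state is frozen once it is above [r]. *)
Definition alive r s : bool := [&& 0 <= s.1, 0 <= s.2 & s.1 + s.2 <= r].

Definition range_step r (u : (R * R) * R) : R * R :=
  if alive r u.1 then (maxr (u.1.1 + u.2) 0, maxr (u.1.2 - u.2) 0) else u.1.

Lemma measurable_alive r : measurable [set s | alive r s].
Proof.
rewrite (_ : [set s | alive r s] = (fst @^-1` `[0, +oo[) `&`
  ((snd @^-1` `[0, +oo[) `&` ((fun s => s.1 + s.2) @^-1` `]-oo, r]))); last first.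
  apply/seteqP; split=> s /=; rewrite !in_itv/= !andbT.
    by move/and3P => [].
  by move=> [? [? ?]]; apply/and3P.
apply: measurableI.
  rewrite -[X in measurable X]setTI; exact: measurable_fst.
apply: measurableI.
  rewrite -[X in measurable X]setTI; exact: measurable_snd.
rewrite -[X in measurable X]setTI.
have : measurable_fun setT (fun s : R * R => s.1 + s.2).
  exact: measurable_funD.
by apply.
Qed.

Lemma measurable_fun_alive r : measurable_fun [set: R * R] (alive r).
Proof.
apply: (measurable_fun_bool true); rewrite setTI.
exact: measurable_alive.
Qed.

Lemma measurable_range_step r : measurable_fun setT (range_step r).
Proof.
apply: measurable_fun_ifT => //.
- by apply: measurableT_comp => //; exact: measurable_fun_alive.
- apply/measurable_fun_pairP; split => /=; apply: measurable_maxr => //.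
    by apply: measurable_funD => //; exact: measurableT_comp.
  by apply: measurable_funB => //; exact: measurableT_comp.
Qed.

Lemma range_step_cases r s x : alive r s ->
  let s' := range_step r (s, x) in
  [/\ 0 <= s'.1, 0 <= s'.2, s'.1 <= `|s.1 + x|, s'.2 <= `|s.2 - x| &
    ~~ alive r s' ->
      (s'.1 = 0 /\ s'.2 = s.2 - x /\ r < s'.2) \/
      (s'.2 = 0 /\ s'.1 = s.1 + x /\ r < s'.1)].
Proof.
move=> al; rewrite /range_step al /=; move: al => /and3P[s1 s2 s12].
rewrite !le_max !lexx !orbT !ge_max !ler_norm !normr_ge0; split => //.
rewrite /alive/= !le_max !lexx !orbT/= -ltNge => H.
case: (leP 0 (s.1 + x)) H => H1.
  case: (leP 0 (s.2 - x)) => H2 H; first by exfalso; lra.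
  by right; rewrite addr0 in H.
case: (leP 0 (s.2 - x)) => H2 H; last by exfalso; lra.
by left; rewrite add0r in H.
Qed.

Section walk.
Context d (T : measurableType d) (P : probability T R) (X : nat -> {RV P >-> R}).

Definition walk k w : R := \sum_(i < k) X i w.

Lemma measurable_walk k : measurable_fun setT (walk k).
Proof. by apply: measurable_sum => i; exact: measurable_funPT. Qed.

HB.instance Definition _ k := isMeasurableFun.Build _ _ _ _ (walk k) (measurable_walk k).

Lemma walkS k w : walk k.+1 w = walk k w + X k w.
Proof. by rewrite /walk big_ord_recr. Qed.

Lemma walk0 w : walk 0 w = 0.
Proof. by rewrite /walk big_ord0. Qed.

Fixpoint range_chain r k w : R * R :=
  if k is j.+1 then range_step r (range_chain r j w, X j w) else (0, 0).

Lemma measurable_range_chain r k : measurable_fun setT (range_chain r k).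
Proof.
elim: k => [|k IH]; first exact: measurable_cst.
apply: (measurableT_comp (measurable_range_step r)).
by apply/measurable_fun_pairP; split => //; exact: measurable_funPT.
Qed.

HB.instance Definition _ r k :=
  isMeasurableFun.Build _ _ _ _ (range_chain r k) (measurable_range_chain r k).

Lemma range_chainP r k w : 0 <= r ->
  if alive r (range_chain r k w) then
    [/\ forall i, (i <= k)%N ->
        - (range_chain r k w).2 <= walk k w - walk i w <= (range_chain r k w).1,
      exists2 i, (i <= k)%N & (range_chain r k w).1 = walk k w - walk i w &
      exists2 i, (i <= k)%N & (range_chain r k w).2 = walk i w - walk k w]
  else exists i j, [/\ (i <= k)%N, (j <= k)%N & r < walk j w - walk i w].
Proof.
move=> r0; elim: k => [|k IH].
  rewrite /alive/= lexx addr0 r0; split.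
  - by move=> i; rewrite leqn0 => /eqP ->; rewrite subrr oppr0 lexx.
  - by exists 0%N => //; rewrite subrr.
  - by exists 0%N => //; rewrite subrr.
rewrite [range_chain r k.+1 w]/=; move: IH; case: ifPn => [al|al]; last first.
  rewrite /range_step (negbTE al) /= (negbTE al) => -[i [j [ik jk H]]].
  by exists i, j; split => //; exact: leqW.
move: (al) => /and3P[s10 s20 s12].
move=> [bnd [i ik Ei] [j jk Ej]].
have stepE : range_step r (range_chain r k w, X k w) =
  (maxr ((range_chain r k w).1 + X k w) 0, maxr ((range_chain r k w).2 - X k w) 0).
  by rewrite /range_step al.
have [_ _ _ _ dead] := range_step_cases (X k w) al.
case: ifPn => [al'|/dead]; last first.
  case=> -[_ [-> H]].
    exists k.+1, j; split => //; first exact: leqW.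
    by rewrite walkS; lra.
  exists i, k.+1; split => //; first exact: leqW.
  by rewrite walkS; lra.
rewrite stepE; split => /=.
- move=> l; rewrite leq_eqVlt => /predU1P[->|].
    by rewrite subrr oppr_le0 !le_max !lexx !orbT.
  rewrite ltnS => /bnd /andP[b1 b2]; rewrite walkS lerNl !le_max.
  by apply/andP; split; apply/orP; left; lra.
- case: (leP 0 ((range_chain r k w).1 + X k w)) => H.
    by exists i; [exact: leqW|rewrite walkS; lra].
  by exists k.+1 => //; rewrite subrr.
- case: (leP 0 ((range_chain r k w).2 - X k w)) => H.
    by exists j; [exact: leqW|rewrite walkS; lra].
  by exists k.+1 => //; rewrite subrr.
Qed.

Lemma range_chain_dead r k : 0 <= r ->
  [set w | ~~ alive r (range_chain r k w)] =
  [set w | exists i j, [/\ (i <= k)%N, (j <= k)%N & r < walk j w - walk i w]].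
Proof.
move=> r0; apply/seteqP; split => w /=.
  by have := range_chainP k w r0; case: ifP.
have := range_chainP k w r0; case: ifPn => // /and3P[_ _ s12] [bnd _ _].
move=> [i [j [/bnd/andP[_ b1] /bnd/andP[b2 _] H]]].
exfalso; lra.
Qed.

End walk.
End range_chain.

Section range_bounds.
Local Open Scope ereal_scope.
Context {R : realType} d (T : measurableType d) (P : probability T R).
Variables (X : nat -> {RV P >-> R}) (f : nat -> R -> R).
Hypothesis indX : mutually_independent P X.
Hypothesis mf : forall k, measurable_fun [set: R] (f k).
Hypothesis f_ge0 : forall k x, (0 <= f k x)%R.
Hypothesis f_mono : forall k x y, (`|x| <= `|y|)%R -> (f k x <= f k y)%R.
Hypothesis f_convD : forall i k x,
  \int[distribution P (X i)]_z (f k (x + z)%R)%:E = (f k.+1 x)%:E.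
Hypothesis f_convB : forall i k x,
  \int[distribution P (X i)]_z (f k (x - z)%R)%:E = (f k.+1 x)%:E.

Let mfD k (a : R) : measurable_fun [set: R] (fun z => (f k (a + z)%R)%:E).
Proof.
by apply/measurable_EFinP; apply: measurableT_comp => //; exact: measurable_funD.
Qed.

Let mfB k (a : R) : measurable_fun [set: R] (fun z => (f k (a - z)%R)%:E).
Proof.
by apply/measurable_EFinP; apply: measurableT_comp => //; exact: measurable_funB.
Qed.

Let conv i k (a b : R) :
  \int[distribution P (X i)]_z (f k (a + z) + f k (b - z))%:E =
  (f k.+1 a + f k.+1 b)%:E.
Proof.
under eq_integral do rewrite EFinD.
by rewrite ge0_integralD ?f_convD ?f_convB// => z _; rewrite lee_fin.
Qed.

Let mV (g : R * R -> R) r : measurable_fun [set: R * R] g ->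
  measurable_fun [set: R * R] (fun s => (if alive r s then g s else 1%R)%:E).
Proof.
move=> mg; apply/measurable_EFinP; apply: measurable_fun_ifT => //.
exact: measurable_fun_alive.
Qed.

Let mVchain (g : R * R -> R) r n : measurable_fun [set: R * R] g ->
  measurable_fun [set: T]
    (fun w => (if alive r (range_chain X r n w)
       then g (range_chain X r n w) else 1%R)%:E).
Proof.
move=> /(mV r) mg.
apply: (@measurableT_comp _ _ _ _ _ _ _ _ (range_chain X r n) mg).
exact: measurable_range_chain.
Qed.

Let mVstep (g : R * R -> R) r s : measurable_fun [set: R * R] g ->
  measurable_fun [set: R]
    (fun z => (if alive r (range_step r (s, z))
       then g (range_step r (s, z)) else 1%R)%:E).
Proof.
move=> /(mV r) mg.
apply: (@measurableT_comp _ _ _ _ _ _ _ _ (fun z => range_step r (s, z)) mg).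
apply: (measurableT_comp (measurable_range_step r)).
exact: measurable_pair1.
Qed.

Let integral_dead r n :
  \int[P]_w (if alive r (range_chain X r n w) then 0%R else 1%R)%:E =
  P [set w | ~~ alive r (range_chain X r n w)].
Proof.
rewrite -[RHS]mul1e -integral_cst; last first.
  rewrite (_ : [set _ | _] = (range_chain X r n) @^-1` (~` [set s | alive r s])).
    apply: measurable_funPTI; apply: measurableC; exact: measurable_alive.
  by apply/seteqP; split => w /= /negP.
rewrite [RHS]integral_mkcond; apply: eq_integral => w _.
rewrite patchE; case: ifPn => al; first by rewrite memNset//=; apply/negP; rewrite negbK.
by rewrite mem_set.
Qed.

Lemma range_walk_ub r n : (0 <= r)%R ->
  (forall k x, (r < x)%R -> (1 <= f k x)%R) ->
  P [set w | ~~ alive r (range_chain X r n w)] <= (f n 0 *+ 2)%:E.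
Proof.
move=> r0 f1.
pose V k s : \bar R := (if alive r s then f k s.1 + f k s.2 else 1)%:E.
apply: (@le_trans _ _ (\int[P]_w V 0%N (range_chain X r n w))).
  rewrite -integral_dead; apply: ge0_le_integral => //.
  - by move=> w _; case: ifP.
  - by have := @mVchain (fun=> 0%R) r n (measurable_cst _).
  - apply: (@mVchain (fun s => f 0%N s.1 + f 0%N s.2)%R r n).
    by apply: measurable_funD; exact: measurableT_comp.
  - by move=> w _; rewrite lee_fin; case: ifP => // _; rewrite addr_ge0.
apply: (le_trans (@chain_supermartingale _ _ _ _ _ indX _ _
  (fun k => range_chain X r k : {RV P >-> _})
  (range_step r) (measurable_range_step r) _ _ V n _ _ _)).
- by exists (0, 0)%R.
- by [].
- move=> k; apply: mV.
  by apply: measurable_funD; exact: measurableT_comp.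
- by move=> k s; rewrite lee_fin; case: ifP => // _; rewrite addr_ge0.
- move=> i k s; rewrite /V; case: ifPn => [al|al]; last first.
    rewrite (eq_integral (cst 1)); last first.
      by move=> z _; rewrite /range_step (negbTE al)/= (negbTE al).
    by rewrite [X in X <= _](integral_probability_cst _ 1%R).
  rewrite -(conv i); apply: ge0_le_integral => //.
  + by move=> z _; rewrite lee_fin; case: ifP => // _; rewrite addr_ge0.
  + apply: (@mVstep (fun s => f k s.1 + f k s.2)%R r s).
    by apply: measurable_funD; exact: measurableT_comp.
  + by under eq_fun do rewrite EFinD; exact: emeasurable_funD.
  + move=> z _; rewrite lee_fin.
    have [s1 s2 s1z s2z dead] := range_step_cases z al.
    case: ifPn => [_|/dead].
      by apply: lerD; apply: f_mono; rewrite [leLHS]ger0_norm.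
    by case=> -[_ [<- /f1 H]]; rewrite (le_trans (H k))// ?lerDl ?lerDr.
- under eq_integral do rewrite /V /alive/= !lexx addr0 r0/=.
  by rewrite integral_probability_cst mulr2n.
Qed.

Lemma range_walk_lb r (dl C : R) (e : R) n : (0 <= r)%R -> (0 <= dl)%R ->
  (0 <= e)%R ->
  (forall k x, (f k x <= 4)%R) ->
  (forall x, (0 <= x <= r + dl)%R -> f 0 x = 0%R) ->
  (1 <= C)%R ->
  (forall k, (k < n)%N -> (f k dl + f k (r + dl *+ 2) <= C)%R) ->
  (forall i, P [set w | (dl < `|X i w|)%R] <= e%:E) ->
  (f n dl *+ 2 / C)%:E <=
    P [set w | ~~ alive r (range_chain X r n w)] + (8 * e *+ n)%:E.
Proof.
move=> r0 dl0 e0 f4 f00 C1 fC tail.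
have C0 : (0 < C)%R by exact: lt_le_trans C1.
pose V k s : \bar R :=
  (if alive r s then (f k (s.1 + dl)%R + f k (s.2 + dl)%R) / C else 1%R)%:E.
have mg k : measurable_fun [set: R * R]
    (fun s => (f k (s.1 + dl) + f k (s.2 + dl)) / C)%R.
  apply: measurable_funM => //; apply: measurable_funD.
    by apply: measurableT_comp => //; exact: measurable_funD.
  by apply: measurableT_comp => //; exact: measurable_funD.
have V0 k s : 0 <= V k s.
  by rewrite lee_fin; case: ifP => // _; rewrite divr_ge0 ?addr_ge0// ltW.
have -> : P [set w | ~~ alive r (range_chain X r n w)] =
    \int[P]_w V 0%N (range_chain X r n w).
  rewrite -integral_dead; apply: eq_integral => w _; rewrite /V.
  case: ifP => // /and3P[s1 s2 s12]; rewrite !f00 ?addr0 ?mul0r// addr_ge0//=.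
    by rewrite lerD2r; lra.
  by rewrite lerD2r; lra.
have e80 : (0 <= 8 * e)%R by rewrite mulr_ge0.
apply: (le_trans _ (@chain_submartingale _ _ _ _ _ indX _ _
  (fun k => range_chain X r k : {RV P >-> _})
  (range_step r) (measurable_range_step r) _ _ V _ n e80 _ V0 _)).
- under eq_integral do rewrite /V /alive/= !lexx addr0 r0/= !add0r -mulr2n.
  by rewrite integral_probability_cst.
- by exists (0, 0)%R.
- by [].
- by move=> k; exact: mV.
- move=> i k s kn; rewrite {1}/V; case: ifPn => [al|al]; last first.
    rewrite (eq_integral (cst 1)); last first.
      by move=> z _; rewrite /V /range_step (negbTE al)/= (negbTE al).
    by rewrite [X in X + _](integral_probability_cst _ 1%R) lee_fin ler_wpDr.
  pose B := [set z : R | (dl < `|z|)%R].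
  have mB : measurable B.
    rewrite (_ : B = normr @^-1` `]dl, +oo[); last first.
      by apply/seteqP; split => z /=; rewrite in_itv/= andbT.
    by rewrite -[X in measurable X]setTI; exact: normr_measurable.
  have mW : measurable_fun [set: R] (fun z => V k (range_step r (s, z))).
    exact: (mVstep r s (mg k)).
  apply: (@le_trans _ _ (\int[distribution P (X i)]_z
      (V k (range_step r (s, z)) + (8 * \1_B z)%:E))); last first.
    rewrite ge0_integralD//; last by apply/measurable_EFinP; exact: measurable_funM.
    rewrite leeD2l//; under eq_integral do rewrite EFinM.
    rewrite ge0_integralZl//=; last by apply/measurable_EFinP.
    by rewrite integral_indic// setIT EFinM lee_pmul2l// tail.
  rewrite mulrC EFinM -(conv i) -ge0_integralZl//; last 3 first.
  + by under eq_fun do rewrite EFinD; exact: emeasurable_funD.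
  + by move=> z _; rewrite lee_fin addr_ge0.
  + by rewrite lee_fin invr_ge0 ltW.
  apply: ge0_le_integral => //.
  + by move=> z _; rewrite mule_ge0// lee_fin ?addr_ge0// invr_ge0 ltW.
  + apply: measurable_funeM.
    by under eq_fun do rewrite EFinD; exact: emeasurable_funD.
  + apply: emeasurable_funD => //.
    by apply/measurable_EFinP; exact: measurable_funM.
  move=> z _; rewrite -EFinM -EFinD lee_fin mulrC ler_pdivrMr//.
  set s' := range_step r (s, z).
  have [s1 s2 s1z s2z dead] := range_step_cases z al.
  have V0' : (0 <= (if alive r s' then (f k (s'.1 + dl) + f k (s'.2 + dl)) / C else 1))%R.
    by have := V0 k s'; rewrite lee_fin.
  have [zB|zB] := boolP (z \in B).
    rewrite indicE zB mulr1.
    apply: (@le_trans _ _ 8%R).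
      by rewrite -[leRHS](_ : 4 + 4 = 8)%R ?lerD//; ring.
    by rewrite -[leLHS]mulr1; apply: ler_pM => //; rewrite lerDr.
  rewrite indicE (negbTE zB) mulr0 addr0.
  have zdl : (`|z| <= dl)%R by move: zB; rewrite notin_setE /B/= => /negP; rewrite -leNgt.
  move: (zdl); rewrite ler_norml => /andP[zl zr].
  move: (al) => /and3P[a1 a2 a12].
  have le1 : (f k (s.1 + dl + z) <= f k (s'.1 + dl))%R.
    apply: f_mono; rewrite [leRHS]ger0_norm ?addr_ge0//.
    rewrite /s' /range_step al/= ler_norml.
    by case: (leP 0%R (s.1 + z)%R) => H; apply/andP; split; lra.
  have le2 : (f k (s.2 + dl - z) <= f k (s'.2 + dl))%R.
    apply: f_mono; rewrite [leRHS]ger0_norm ?addr_ge0//.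
    rewrite /s' /range_step al/= ler_norml.
    by case: (leP 0%R (s.2 - z)%R) => H; apply/andP; split; lra.
  apply: (le_trans (lerD le1 le2)).
  case: ifPn => [_|/dead].
    by rewrite divfK// gt_eqF.
  rewrite mul1r.
  case=> -[E0 [E1 H]]; apply: (le_trans _ (fC k kn)).
    rewrite E0 add0r lerD2l; apply: f_mono.
    by rewrite !ger0_norm ?addr_ge0 ?mulrn_wge0// mulr2n E1; lra.
  rewrite E0 add0r addrC lerD2l; apply: f_mono.
  by rewrite !ger0_norm ?addr_ge0 ?mulrn_wge0// mulr2n E1; lra.
Qed.

End range_bounds.

(** * The range of a Gaussian walk *)

Lemma Phi_window_mono (R : realType) (a u v : R) : 0 <= a -> 0 <= u -> u <= v ->
  Phi (u - a) + Phi (- u - a) <= Phi (v - a) + Phi (- v - a).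
Proof.
move=> a0 u0 uv.
pose m x : R := Phi (x - a) + Phi (- x - a).
have dm (x : R) : is_derive x 1 m (phi (x - a) - phi (x + a)).
  have d1 : is_derive x 1 (fun t : R => t - a) 1.
    by apply: is_derive_eq; rewrite subr0.
  have d2 : is_derive x 1 (fun t : R => - t - a) (- 1).
    by apply: is_derive_eq; rewrite subr0.
  have D1 := @is_derive1_comp R Phi (fun t => t - a) x _ _ (is_derive_Phi (x - a)) d1.
  have D2 := @is_derive1_comp R Phi (fun t => - t - a) x _ _ (is_derive_Phi (- x - a)) d2.
  have H := is_deriveD D1 D2; apply: (is_derive_eq H).
  by rewrite mulr1 mulrN1 -opprD /phi sqrrN.
suff : m u <= m v by [].
apply: (@ger0_derive1_ndecry _ m 0) => //.
- move=> x; rewrite in_itv/= andbT => x0; rewrite derive1E; case: (dm x) => _ ->.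
  rewrite subr_ge0 /phi ler_pM2l ?normal_peak_gt0 ?oner_neq0// ler_expR.
  rewrite ler_pM2r ?invr_gt0// lerN2 -subr_ge0.
  have -> : (x + a) ^+ 2 - (x - a) ^+ 2 = 4 * (x * a) by ring.
  by rewrite mulr_ge0// mulr_ge0// ltW.
- apply: continuous_subspaceT => x.
  by apply/differentiable_continuous/derivable1_diffP; case: (dm x).
Qed.

Section gaussian_walk.
Local Open Scope ereal_scope.
Context {R : realType} d (T : measurableType d) (P : probability T R).
Variables (X : nat -> {RV P >-> R}) (h : R).
Hypothesis h0 : (0 < h)%R.
Hypothesis indX : mutually_independent P X.
Hypothesis lawX : forall i A, measurable A ->
  distribution P (X i) A = normal_prob 0 (Num.sqrt h) A.
Hypothesis law_walk : forall k A, measurable A ->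
  distribution P (walk X k.+1 : {RV P >-> R}) A =
  normal_prob 0 (Num.sqrt (k.+1%:R * h)) A.

(* The probability that the walk exceeds [x] after [k] steps. *)
Definition wtail k (x : R) : R :=
  if k is j.+1 then Phi (- x / Num.sqrt (k%:R * h)) else (x < 0)%R%:R.

Let sqrt_gt0 k : (0 < Num.sqrt (k.+1%:R * h))%R.
Proof. by rewrite sqrtr_gt0 mulr_gt0. Qed.

Lemma wtail_ge0 k x : (0 <= wtail k x)%R.
Proof. by case: k => [|k] /=; [exact: ler0n|exact: Phi_ge0]. Qed.

Lemma wtail_le1 k x : (wtail k x <= 1)%R.
Proof. by case: k => [|k] /=; [case: ltP|exact: Phi_le1]. Qed.

Lemma measurable_wtail k : measurable_fun [set: R] (wtail k).
Proof.
case: k => [|k] /=.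
  have -> : wtail 0 = \1_`]-oo, 0%R[.
    by apply/funext => x; rewrite indicE mem_setE in_itv.
  by apply: measurable_indic; exact: measurable_itv.
apply: measurableT_comp.
  by apply: continuous_measurable_fun; exact: continuous_Phi.
by apply: measurable_funM => //; exact: measurableT_comp.
Qed.

Lemma walk_gt k x : P [set w | (x < walk X k w)%R] = (wtail k x)%:E.
Proof.
case: k => [|k].
  rewrite /=; under eq_set do rewrite walk0.
  case: (ltP x 0%R) => x0.
    by rewrite (_ : [set _ | _] = setT) ?probability_setT//; apply/seteqP; split.
  by rewrite (_ : [set _ | _] = set0) ?measure0//; apply/seteqP; split.
rewrite -normal_prob_tail// -law_walk; last exact: measurable_itv.
rewrite /distribution /pushforward; congr (P _); apply/seteqP; split => w /=;
  by rewrite in_itv/= andbT.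
Qed.

Lemma walk_lt k x : P [set w | (walk X k w < - x)%R] = (wtail k x)%:E.
Proof.
case: k => [|k].
  rewrite /=; under eq_set do rewrite walk0 oppr_gt0.
  case: (ltP x 0%R) => x0.
    by rewrite (_ : [set _ | _] = setT) ?probability_setT//; apply/seteqP; split.
  by rewrite (_ : [set _ | _] = set0) ?measure0//; apply/seteqP; split.
rewrite -normal_prob_Ny// -law_walk; last exact: measurable_itv.
rewrite /distribution /pushforward; congr (P _); apply/seteqP; split => w /=;
  by rewrite in_itv/=.
Qed.

Let eq_law i k (g : R -> \bar R) :
  \int[distribution P (X i)]_z g z = \int[distribution P (X k)]_z g z.
Proof. by apply: eq_measure_integral => A mA _; rewrite [LHS]lawX// [RHS]lawX. Qed.

Let addu (u : R * R) : R := (u.1 + u.2)%R.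

Let maddu : measurable_fun [set: R * R] addu.
Proof. exact: measurable_funD. Qed.

Let swap k (A : set R) : measurable A ->
  P [set w | A (walk X k.+1 w)] =
  \int[distribution P (X k)]_z P [set w | A (walk X k w + z)%R].
Proof.
move=> mA.
have mwA j (z : R) : measurable [set w | A (walk X j w + z)%R].
  have mw : measurable_fun [set: T] (fun w => walk X j w + z)%R.
    by apply: measurable_funD => //; exact: measurable_walk.
  by rewrite -[X in measurable X]setTI; exact: mw.
have H : \int[P]_w (\1_A (addu (walk X k w, X k w)))%:E =
    \int[distribution P (X k)]_z \int[P]_w (\1_A (addu (walk X k w, z)))%:E.
  apply: (@chain_integral_swap _ _ _ P X indX _ _
    (fun k => walk X k : {RV P >-> R}) addu maddu _ _ k (fun u => (\1_A (addu u))%:E)).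
  - by exists 0%R => w; exact: walk0.
  - by move=> j w; rewrite /addu/= walkS.
  - by apply/measurable_EFinP; apply: measurableT_comp.
  - by move=> u; rewrite lee_fin.
transitivity (\int[P]_w (\1_A (addu (walk X k w, X k w)))%:E).
  transitivity (\int[P]_w (\1_[set w | A (walk X k.+1 w + 0)%R] w)%:E).
    rewrite integral_indic// setIT; congr (P _).
    by apply/seteqP; split => w /=; rewrite addr0.
  apply: eq_integral => w _; rewrite !indicE; congr ((nat_of_bool _)%:R%:E).
  by apply/idP/idP => /set_mem/= Aw; apply/mem_set; move: Aw;
    rewrite /= /addu/= addr0 walkS.
rewrite H; apply: eq_integral => z _.
transitivity (\int[P]_w (\1_[set w | A (walk X k w + z)%R] w)%:E); last first.
  by rewrite integral_indic// setIT.
apply: eq_integral => w _; rewrite !indicE; congr ((nat_of_bool _)%:R%:E).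
Qed.

Lemma wtail_convB i k x :
  \int[distribution P (X i)]_z (wtail k (x - z))%:E = (wtail k.+1 x)%:E.
Proof.
rewrite (eq_law i k) -walk_gt (@swap k [set y | x < y]%R); last first.
  by rewrite -set_itvoy; exact: measurable_itv.
apply: eq_integral => z _; rewrite -walk_gt; congr (P _).
by apply/seteqP; split => w /=; rewrite ltrBlDr.
Qed.

Lemma wtail_convD i k x :
  \int[distribution P (X i)]_z (wtail k (x + z))%:E = (wtail k.+1 x)%:E.
Proof.
rewrite (eq_law i k) -walk_lt (@swap k [set y | y < - x]%R); last first.
  by rewrite -set_itvNyo; exact: measurable_itv.
apply: eq_integral => z _; rewrite -walk_lt; congr (P _).
by apply/seteqP; split => w /=; rewrite opprD ltrBrDr.
Qed.

Lemma wtail_nonincreasing k (x y : R) : (x <= y)%R -> (wtail k y <= wtail k x)%R.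
Proof.
case: k => [|k] xy /=.
  by case: (ltP y 0%R) => // y0; rewrite (le_lt_trans xy y0).
by apply: Phi_nondecreasing; rewrite ler_pM2r ?invr_gt0// lerN2.
Qed.

Lemma wtail_ge_half k (x : R) : (x < 0)%R -> (2^-1 <= wtail k x)%R.
Proof.
move=> x0; case: k => [|k] /=; first by rewrite x0 invf_le1// ler1n.
rewrite -Phi0; apply: Phi_nondecreasing.
by rewrite mulr_ge0 ?invr_ge0 ?ltW// oppr_gt0.
Qed.

Lemma wtail_le_half k (x : R) : (0 <= x)%R -> (wtail k x <= 2^-1)%R.
Proof.
move=> x0; case: k => [|k] /=; first by rewrite ltNge x0/= invr_ge0.
rewrite -Phi0; apply: Phi_nondecreasing.
by rewrite mulNr oppr_le0 divr_ge0// ltW.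
Qed.

Lemma wtail_nondecreasing_time k n (x : R) : (0 <= x)%R -> (k <= n)%N ->
  (wtail k x <= wtail n x)%R.
Proof.
move=> x0; case: k n => [|k] [|n] // kn.
  by rewrite [leLHS]/= ltNge x0 wtail_ge0.
apply: Phi_nondecreasing; rewrite !mulNr lerN2 ler_wpM2l//.
by rewrite lef_pV2 ?posrE// ler_wsqrtr// ler_pM2r// ler_nat.
Qed.

(* This is [2 * P (`|x + walk X k| > rho)]: by the reflection principle, almost
   the probability that a walk reflected at 0 and started from [x] passes [rho]
   within [k] steps. *)
Definition wtail2 rho k x : R := (2 * wtail k (rho - x) + 2 * wtail k (rho + x))%R.

Lemma wtail2_ge0 rho k x : (0 <= wtail2 rho k x)%R.
Proof. by rewrite addr_ge0// mulr_ge0// wtail_ge0. Qed.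

Lemma wtail2_le4 rho k x : (wtail2 rho k x <= 4)%R.
Proof.
rewrite /wtail2; have := wtail_le1 k (rho - x); have := wtail_le1 k (rho + x).
by move=> ? ?; lra.
Qed.

Lemma measurable_wtail2 rho k : measurable_fun [set: R] (wtail2 rho k).
Proof.
apply: measurable_funD; apply: measurable_funM => //;
  apply: measurableT_comp => //; try exact: measurable_wtail.
  exact: measurable_funB.
exact: measurable_funD.
Qed.

Let wtail2_mono_nneg (rho : R) k (x y : R) :
  (0 <= rho)%R -> (0 <= x)%R -> (x <= y)%R ->
  (wtail2 rho k x <= wtail2 rho k y)%R.
Proof.
move=> rho0 x0 xy.
rewrite /wtail2 -!mulrDr ler_pM2l//; case: k => [|k] /=.
  rewrite ![(rho + _ < 0)%R]ltNge (addr_ge0 rho0 x0) (addr_ge0 rho0 (le_trans x0 xy)).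
  rewrite /= !addr0 !subr_ge0 -!ltNge; case: (ltP rho x) => // rx.
  by rewrite (lt_le_trans rx xy).
move: (sqrt_gt0 k); move: (Num.sqrt _) => s s0.
have E (z : R) : (Phi (- (rho - z) / s) + Phi (- (rho + z) / s) =
    Phi (z / s - rho / s) + Phi (- (z / s) - rho / s))%R.
  by congr (Phi _ + Phi _)%R; ring.
rewrite (E x) (E y).
have a0 : (0 <= rho / s)%R by rewrite divr_ge0// ltW.
have u0 : (0 <= x / s)%R by rewrite divr_ge0// ltW.
have uv : (x / s <= y / s)%R by rewrite ler_pM2r// invr_gt0.
exact: (Phi_window_mono a0 u0 uv).
Qed.

Lemma wtail2_mono (rho : R) k (x y : R) : (0 <= rho)%R -> (`|x| <= `|y|)%R ->
  (wtail2 rho k x <= wtail2 rho k y)%R.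
Proof.
move=> rho0 xy.
have abs (z : R) : wtail2 rho k z = wtail2 rho k `|z|.
  by case: (ger0P z) => // _; rewrite /wtail2 opprK addrC.
by rewrite (abs x) (abs y); exact: wtail2_mono_nneg.
Qed.

Let wtail2_conv i k a b (g1 g2 : R -> R) :
  measurable_fun [set: R] g1 -> measurable_fun [set: R] g2 ->
  \int[distribution P (X i)]_z (wtail k (g1 z))%:E = (wtail k.+1 a)%:E ->
  \int[distribution P (X i)]_z (wtail k (g2 z))%:E = (wtail k.+1 b)%:E ->
  \int[distribution P (X i)]_z (2 * wtail k (g1 z) + 2 * wtail k (g2 z))%:E =
  (2 * wtail k.+1 a + 2 * wtail k.+1 b)%:E.
Proof.
move=> mg1 mg2 E1 E2; under eq_integral do rewrite EFinD !EFinM.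
have m1 : measurable_fun [set: R] (fun z => (wtail k (g1 z))%:E).
  by apply/measurable_EFinP; apply: measurableT_comp => //; exact: measurable_wtail.
have m2 : measurable_fun [set: R] (fun z => (wtail k (g2 z))%:E).
  by apply/measurable_EFinP; apply: measurableT_comp => //; exact: measurable_wtail.
rewrite ge0_integralD//.
- by rewrite !ge0_integralZl ?E1 ?E2// => z _; rewrite lee_fin wtail_ge0.
- by move=> z _; rewrite -EFinM lee_fin mulr_ge0// wtail_ge0.
- exact: measurable_funeM.
- by move=> z _; rewrite -EFinM lee_fin mulr_ge0// wtail_ge0.
- exact: measurable_funeM.
Qed.

Lemma wtail2_convB rho i k x :
  \int[distribution P (X i)]_z (wtail2 rho k (x - z)%R)%:E = (wtail2 rho k.+1 x)%:E.
Proof.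
apply: wtail2_conv.
- by apply: measurable_funB => //; exact: measurable_funB.
- by apply: measurable_funD => //; exact: measurable_funB.
- by rewrite -(wtail_convD i); apply: eq_integral => z _; rewrite opprB addrA addrAC.
- by rewrite -(wtail_convB i); apply: eq_integral => z _; rewrite addrA.
Qed.

Lemma wtail2_convD rho i k x :
  \int[distribution P (X i)]_z (wtail2 rho k (x + z)%R)%:E = (wtail2 rho k.+1 x)%:E.
Proof.
apply: wtail2_conv.
- by apply: measurable_funB => //; exact: measurable_funD.
- by apply: measurable_funD => //; exact: measurable_funD.
- by rewrite -(wtail_convB i); apply: eq_integral => z _; rewrite opprD addrA.
- by rewrite -(wtail_convD i); apply: eq_integral => z _; rewrite addrA.
Qed.

Lemma gaussian_range_ub r n : (0 <= r)%R ->
  P [set w | ~~ alive r (range_chain X r n.+1 w)] <=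
    (8 * Phi (- r / Num.sqrt (n.+1%:R * h)))%:E.
Proof.
move=> r0.
apply: (le_trans (@range_walk_ub _ _ _ _ X (wtail2 r) indX
  (measurable_wtail2 r) (wtail2_ge0 r)
  (fun k x y => wtail2_mono k r0) (wtail2_convD r) (wtail2_convB r) r n.+1 r0 _)).
  move=> k x rx; rewrite /wtail2.
  have := @wtail_ge_half k (r - x); rewrite subr_lt0 => /(_ rx).
  by have := wtail_ge0 k (r + x); lra.
by rewrite lee_fin /wtail2 subr0 addr0 /= -mulr_natr; lra.
Qed.

Lemma gaussian_range_lb r (dl : R) n : (0 <= r)%R -> (0 <= dl)%R ->
  (8 * Phi (- (r + dl *+ 2) / Num.sqrt (n.+1%:R * h)) /
    (1 + 6 * Phi (- r / Num.sqrt (n.+1%:R * h))))%:E <=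
  P [set w | ~~ alive r (range_chain X r n.+1 w)] +
    (16 * Phi (- dl / Num.sqrt h) *+ n.+1)%:E.
Proof.
move=> r0 dl0; set s := Num.sqrt (_ * _); set C := (1 + _)%R.
have C1 : (1 <= C)%R by rewrite lerDl mulr_ge0// Phi_ge0.
have C0 : (0 < C)%R by exact: lt_le_trans C1.
pose rho := (r + dl *+ 2)%R.
have dl20 : (0 <= dl *+ 2)%R by rewrite mulrn_wge0.
have rho0 : (0 <= rho)%R by rewrite addr_ge0.
pose e : R := (2 * Phi (- dl / Num.sqrt h))%R.
have e0 : (0 <= e)%R by rewrite mulr_ge0// Phi_ge0.
have := @range_walk_lb _ _ _ _ X (wtail2 rho) indX
  (measurable_wtail2 rho) (wtail2_ge0 rho)
  (fun k x y => wtail2_mono k rho0) (wtail2_convD rho) (wtail2_convB rho) r dl C e n.+1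
  r0 dl0 e0 (wtail2_le4 rho) _ C1 _ _.
have -> : (8 * e = 16 * Phi (- dl / Num.sqrt h))%R by rewrite /e; ring.
move=> H; apply: (le_trans _ (H _ _ _)).
- rewrite lee_fin ler_pM2r ?invr_gt0//.
  have : (wtail2 rho n.+1 0 <= wtail2 rho n.+1 dl)%R.
    by apply: wtail2_mono => //; rewrite normr0.
  by rewrite {1}/wtail2 subr0 addr0 /= -mulr_natr -/s -/rho; lra.
- move=> x /andP[x0 xr]; rewrite /wtail2 /= !ltNge.
  have -> : (0 <= rho - x)%R by rewrite subr_ge0 /rho mulr2n addrA; lra.
  by rewrite addr_ge0//= mulr0 addr0.
- move=> k kn; rewrite /wtail2 /C.
  have rr : (wtail k r <= Phi (- r / s))%R.
    exact: (@wtail_nondecreasing_time k n.+1 r r0 (ltnW kn)).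
  have mono y : (r <= y)%R -> (wtail k y <= Phi (- r / s))%R.
    by move=> ry; apply: le_trans rr; exact: wtail_nonincreasing.
  have h1 := @mono (rho - dl)%R; have h2 := @mono (rho + dl)%R.
  have h3 := @mono (rho + rho)%R; have h4 := @wtail_le_half k 0 (lexx _).
  rewrite subrr.
  have {}h1 := h1 _; have {}h2 := h2 _; have {}h3 := h3 _.
  move: h1 h2 h3; rewrite /rho mulr2n => h1 h2 h3.
  have {}h1 := h1 ltac:(lra); have {}h2 := h2 ltac:(lra).
  by have {}h3 := h3 ltac:(lra); lra.
- move=> i.
  have sh : (0 < Num.sqrt h)%R by rewrite sqrtr_gt0.
  have m1 : measurable (X i @^-1` `]dl, +oo[).
    by apply: measurable_funPTI; exact: measurable_itv.
  have m2 : measurable (X i @^-1` `]-oo, (- dl)%R[).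
    by apply: measurable_funPTI; exact: measurable_itv.
  have -> : [set w | (dl < `|X i w|)%R] =
      X i @^-1` `]dl, +oo[ `|` X i @^-1` `]-oo, (- dl)%R[.
    apply/seteqP; split => w /=; rewrite !in_itv/= andbT ltr_normr ltrNr.
      by case/orP; [left|right].
    by case=> ->; rewrite ?orbT.
  apply: (le_trans (measureU2 _ m1 m2)).
  rewrite [X in X + _](_ : _ = (Phi (- dl / Num.sqrt h))%:E); last first.
    rewrite -normal_prob_tail// -(lawX i)//; exact: measurable_itv.
  rewrite [X in _ + X](_ : _ = (Phi (- dl / Num.sqrt h))%:E); last first.
    rewrite -normal_prob_Ny// -(lawX i)//; exact: measurable_itv.
  by rewrite -EFinD lee_fin /e; lra.
Qed.

End gaussian_walk.

(** * The range of Brownian motion *)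

Lemma nbhs_infty_gtr_succ (R : realType) (r : R) : \forall n \near \oo, r < n.+1%:R.
Proof.
near=> n; apply: (@lt_trans _ _ n%:R); last by rewrite ltr_nat.
by near: n; exact: nbhs_infty_gtr.
Unshelve. all: by end_near. Qed.

Section path_range.
Context {R : realType}.
Implicit Types (q r : R) (f : R -> R).

Lemma path_rangeP q f : 0 <= q -> {within [set t | 0 <= t], continuous f} ->
  exists c c', [/\ 0 <= c <= q, 0 <= c' <= q, path_range q f = f c - f c' &
    forall t, 0 <= t <= q -> f c' <= f t <= f c].
Proof.
move=> q0 cf.
have cfq : {within `[0, q], continuous f}.
  by apply: continuous_subspaceW cf => t /=; rewrite in_itv/= => /andP[].
have [c cq fc] := EVT_max q0 cfq; have [c' cq' fc'] := EVT_min q0 cfq.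
exists c, c'; split.
- by move: cq; rewrite in_itv.
- by move: cq'; rewrite in_itv.
- rewrite /path_range; congr (_ - _).
    apply/eqP; rewrite eq_le; apply/andP; split.
      apply: ge_sup; first by exists (f c); exists c.
      by move=> _ [t tq <-]; exact: fc.
    apply: ub_le_sup; last by exists c.
    by exists (f c) => _ [t tq <-]; exact: fc.
  apply/eqP; rewrite eq_le; apply/andP; split.
    apply: ge_inf; last by exists c'.
    by exists (f c') => _ [t tq <-]; exact: fc'.
  apply: lb_le_inf; first by exists (f c'); exists c'.
  by move=> _ [t tq <-]; exact: fc'.
- by move=> t tq; rewrite fc' ?fc// in_itv.
Qed.

Definition grid q n k : R := k%:R * (q / n.+1%:R).

Lemma grid_ge0 q n k : 0 <= q -> 0 <= grid q n k.
Proof. by move=> q0; rewrite mulr_ge0// divr_ge0. Qed.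

Lemma grid_le q n k : 0 <= q -> (k <= n.+1)%N -> grid q n k <= q.
Proof.
move=> q0 kn; rewrite /grid mulrCA -[leRHS]mulr1 ler_wpM2l//.
by rewrite ler_pdivrMr// mul1r ler_nat.
Qed.

Lemma near_grid q f (c e : R) : 0 < q -> {within [set t | 0 <= t], continuous f} ->
  0 <= c <= q -> 0 < e ->
  \forall n \near \oo, exists2 k, (k <= n.+1)%N & `|f c - f (grid q n k)| < e.
Proof.
move=> q0 cf /andP[c0 cq] e0.
have := (subspace_continuousP _ _).1 cf c c0.
move=> /cvgrPdist_lt /(_ _ e0) [dl /= dl0 H].
near=> n.
have h0 : 0 < q / n.+1%:R by rewrite divr_gt0.
have := truncn_itv (divr_ge0 c0 (ltW h0)).
set k := truncn _; rewrite ler_pdivlMr// ltr_pdivrMr// => /andP[k1 k2].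
exists k.
  rewrite -(ler_nat R) -(ler_pM2r h0) (le_trans k1)// mulrC divfK//.
apply: H; last exact: grid_ge0 (ltW q0).
rewrite /= ger0_norm ?subr_ge0//.
apply: (@lt_trans _ _ (q / n.+1%:R)).
  by rewrite ltrBlDl /grid; move: k2; rewrite -(natr1 k) mulrDl mul1r.
rewrite ltr_pdivrMr// mulrC -ltr_pdivrMr//.
near: n; exact: nbhs_infty_gtr_succ.
Unshelve. all: by end_near. Qed.

End path_range.

Section brownian_range.
Local Open Scope ereal_scope.
Context {R : realType} (q : R) (q0 : (0 < q)%R).
Context d (T : measurableType d) (P : probability T R) (W : R -> {RV P >-> R}).
Hypothesis bmW : standard_brownian_motion P W.

Definition incr n i : {RV P >-> R} :=
  (W (grid q n i.+1) \- W (grid q n i) : {RV P >-> R})%R.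

Let h n : R := (q / n.+1%:R)%R.

Let h0 n : (0 < h n)%R. Proof. by rewrite divr_gt0. Qed.

Let hq n : (n.+1%:R * h n = q)%R. Proof. by rewrite mulrC divfK. Qed.

Let indX n : mutually_independent P (incr n).
Proof.
apply: (bm_independent_increments bmW); first by rewrite grid_ge0// ltW.
by move=> i j ij; rewrite /grid ler_pM2r ?h0// ler_nat.
Qed.

Let lawX n i A : measurable A ->
  distribution P (incr n i) A = normal_prob 0 (Num.sqrt (h n)) A.
Proof.
move=> mA.
have t0 : (0 <= grid q n i)%R by rewrite grid_ge0// ltW.
have t1 : (grid q n i < grid q n i.+1)%R by rewrite /grid ltr_pM2r ?h0// ltr_nat.
have -> : h n = (grid q n i.+1 - grid q n i)%R.
  by rewrite /grid -(natr1 i) mulrDl mul1r addrAC subrr add0r.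
exact: (bm_gaussian_increments bmW t0 t1 mA).
Qed.

Let walkE n k w : walk (incr n) k w = (W (grid q n k) w - W 0%R w)%R.
Proof.
rewrite /walk; elim: k => [|k IH].
  by rewrite big_ord0 /grid mul0r subrr.
by rewrite big_ord_recr /= IH addrC addrA subrK.
Qed.

Let law_walk n k A : measurable A ->
  distribution P (walk (incr n) k.+1 : {RV P >-> R}) A =
  normal_prob 0 (Num.sqrt (k.+1%:R * h n)) A.
Proof.
move=> mA.
have gt0 : (0 < grid q n k.+1)%R by rewrite mulr_gt0// h0.
transitivity (distribution P (W (grid q n k.+1) \- W 0%R : {RV P >-> R})%R A).
  rewrite /distribution /pushforward; congr (P _).
  by apply/seteqP; split => w /=; rewrite walkE.
have := bm_gaussian_increments bmW (lexx 0%R) gt0 mA.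
by rewrite subr0.
Qed.

Let dead r n := [set w | ~~ alive r (range_chain (incr n) r n.+1 w)].

Let deadE r n : (0 <= r)%R -> dead r n =
  [set w | exists i j, [/\ (i <= n.+1)%N, (j <= n.+1)%N &
    (r < W (grid q n j) w - W (grid q n i) w)%R]].
Proof.
move=> r0; rewrite /dead range_chain_dead//; apply/seteqP.
by split => w [i [j [ni nj H]]]; exists i, j; split => //; move: H;
  rewrite !walkE opprB addrA subrK.
Qed.

Let measurable_dead r n : measurable (dead r n).
Proof.
rewrite (_ : dead r n = range_chain (incr n) r n.+1 @^-1` (~` [set s | alive r s])).
  by apply: measurable_funPTI; apply: measurableC; exact: measurable_alive.
by apply/seteqP; split => w /= /negP.
Qed.

Definition range_gt r := [set w | (r < path_range q (fun t => W t w))%R].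

Let range_gtE r : (0 <= r)%R ->
  range_gt r = \bigcup_m \bigcap_(n in [set n | (m <= n)%N]) dead r n.
Proof.
move=> r0; apply/seteqP; split => w.
  rewrite /range_gt /=.
  have cw := @bm_continuous_paths _ _ _ _ _ bmW w.
  have [c [c' [cq c'q -> _]]] := path_rangeP (ltW q0) cw => H.
  pose e := ((W c w - W c' w - r) / 2)%R.
  have e0 : (0 < e)%R by rewrite divr_gt0// subr_gt0.
  have [m1 _ H1] := near_grid q0 cw cq e0.
  have [m2 _ H2] := near_grid q0 cw c'q e0.
  exists (maxn m1 m2) => // n /= mn; rewrite deadE//=.
  have [j jn /ltr_distlBl Hj] := H1 n (leq_trans (leq_maxl _ _) mn).
  have [i iN /ltr_distlCDr Hi] := H2 n (leq_trans (leq_maxr _ _) mn).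
  exists i, j; split => //; move: Hj Hi; rewrite /e; lra.
move=> [m _ /(_ m (leqnn m))]; rewrite deadE// => -[i [j [im jm H]]].
have [c [c' [cq c'q E b]]] := path_rangeP (ltW q0) (@bm_continuous_paths _ _ _ _ _ bmW w).
rewrite /range_gt/= E.
have /andP[_ bj] : (W c' w <= W (grid q m j) w <= W c w)%R.
  by apply: b; rewrite grid_ge0 ?grid_le// ltW.
have /andP[bi _] : (W c' w <= W (grid q m i) w <= W c w)%R.
  by apply: b; rewrite grid_ge0 ?grid_le// ltW.
by rewrite (lt_le_trans H)// lerB.
Qed.

Lemma measurable_range_gt r : (0 <= r)%R -> measurable (range_gt r).
Proof.
move=> r0; rewrite range_gtE//; apply: bigcup_measurable => m _.
by apply: bigcap_measurableType => n _; exact: measurable_dead.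
Qed.

Let dead_ub r n : (0 <= r)%R -> P (dead r n) <= (8 * Phi (- r / Num.sqrt q))%:E.
Proof.
move=> r0.
have := gaussian_range_ub (h0 n) (@indX n) (@lawX n) (@law_walk n) n r0.
by rewrite hq.
Qed.

Lemma range_gt_ub r : (0 <= r)%R ->
  P (range_gt r) <= (8 * Phi (- r / Num.sqrt q))%:E.
Proof.
move=> r0; rewrite range_gtE//.
set F := fun m => \bigcap_(n in [set n | (m <= n)%N]) dead r n.
have mF m : measurable (F m).
  by apply: bigcap_measurableType => n _; exact: measurable_dead.
have : P \o F @ \oo --> P (\bigcup_m F m).
  apply: nondecreasing_cvg_mu => //; first exact: bigcup_measurable.
  move=> m n mn; apply/subsetPset => w Fw k /= nk.
  by apply: Fw => /=; exact: leq_trans nk.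
move/cvge_to_le; apply; near=> m => /=.
apply: le_trans (dead_ub m r0); apply: le_measure.
- by apply/mem_set; exact: mF.
- by apply/mem_set; exact: measurable_dead.
- by move=> w; apply => /=.
Unshelve. all: by end_near. Qed.

Let dead_sub r n : (0 <= r)%R -> P (dead r n) <= P (range_gt r).
Proof.
move=> r0; apply: le_measure.
- by apply/mem_set; exact: measurable_dead.
- by apply/mem_set; exact: measurable_range_gt.
move=> w; rewrite deadE// => -[i [j [im jm H]]].
have [c [c' [cq c'q E b]]] := path_rangeP (ltW q0) (@bm_continuous_paths _ _ _ _ _ bmW w).
rewrite /range_gt/= E.
have /andP[_ bj] : (W c' w <= W (grid q n j) w <= W c w)%R.
  by apply: b; rewrite grid_ge0 ?grid_le// ltW.
have /andP[bi _] : (W c' w <= W (grid q n i) w <= W c w)%R.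
  by apply: b; rewrite grid_ge0 ?grid_le// ltW.
by rewrite (lt_le_trans H)// lerB.
Qed.

Lemma range_gt_lb r : (0 <= r)%R ->
  (8 * Phi (- r / Num.sqrt q) / (1 + 6 * Phi (- r / Num.sqrt q)))%:E <= P (range_gt r).
Proof.
move=> r0; set C := (1 + _)%R.
have fP : P (range_gt r) \is a fin_num.
  by rewrite fin_num_measure//; exact: measurable_range_gt.
rewrite -(fineK fP) lee_fin; set p := fine _.
have lb dl n : (0 <= dl)%R ->
    (8 * Phi (- (r + dl *+ 2) / Num.sqrt q) / C -
     16 * Phi (- dl / Num.sqrt (h n)) *+ n.+1 <= p)%R.
  move=> dl0.
  have := gaussian_range_lb (h0 n) (@indX n) (@lawX n) (@law_walk n) n r0 dl0.
  rewrite hq -/C => H; rewrite lerBlDr -lee_fin (le_trans H)// EFinD leeD2r//.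
  by rewrite fineK// dead_sub.
have lb' dl : (0 < dl)%R -> (8 * Phi (- (r + dl *+ 2) / Num.sqrt q) / C <= p)%R.
  move=> dl0.
  set L := (_ / C)%R.
  have : ((L - 16 * Phi (- dl / Num.sqrt (h n)) *+ n.+1)%R @[n --> \oo] --> L)%R.
    rewrite -[X in _ --> X]subr0; apply: cvgB; first exact: cvg_cst.
    pose M : R := (16 * (normal_peak 1 * 8) * q ^+ 2 / dl ^+ 4)%R.
    apply: (@squeeze_cvgr _ _ _ _ (fun=> 0%R) (fun n => M * n.+1%:R^-1)%R).
    + near=> n; rewrite mulrn_wge0 ?mulr_ge0 ?Phi_ge0//=.
      have sh : (0 < Num.sqrt (h n))%R by rewrite sqrtr_gt0.
      have x1 : (1 <= dl / Num.sqrt (h n))%R.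
        rewrite ler_pdivlMr// mul1r -(ger0_norm (ltW dl0)) -sqrtr_sqr ler_sqrt ?sqr_ge0//.
        rewrite ler_pdivrMr// -ler_pdivrMl ?exprn_gt0// mulrC ltW//.
        by near: n; exact: nbhs_infty_gtr_succ.
      rewrite -mulr_natr mulNr (le_trans (ler_wpM2r _ (ler_wpM2l _ (Phi_tail x1))))//.
      rewrite le_eqVlt; apply/orP; left; apply/eqP.
      have s4 : (Num.sqrt (h n) ^+ 4 = h n ^+ 2)%R.
        by rewrite (exprM _ 2 2) sqr_sqrtr// ltW.
      rewrite expr_div_n s4.
      by rewrite /M /h; field; rewrite nat1r pnatr_eq0 !gt_eqF.
    + exact: cvg_cst.
    + by rewrite -[X in _ --> X](mulr0 M); apply: cvgMr; exact: cvg_harmonic.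
  by move/cvgr_to_le; apply; near=> n; apply: lb; exact: ltW.
have : ((8 * Phi (- (r + dl *+ 2) / Num.sqrt q) / C)%R @[dl --> 0^'+] -->
        (8 * Phi (- r / Num.sqrt q) / C)%R)%R.
  apply: cvgMl; apply: cvgMr.
  apply: (@cvg_comp _ _ _ (fun dl => - (r + dl *+ 2) / Num.sqrt q)%R Phi);
    last exact: continuous_Phi.
  apply: cvgMl; apply: cvgN; rewrite -[X in _ --> X]addr0.
  apply: cvgD; first exact: cvg_cst.
  rewrite -[X in _ --> X](mul0rn _ 2); apply: cvgMn.
  by apply: cvg_at_right_filter; exact: cvg_id.
move/cvgr_to_le; apply; near=> dl; apply: lb'; near: dl; exact: nbhs_right_gt.
Unshelve. all: by end_near. Qed.

End brownian_range.

(** * Convergence of maxima to the Gumbel distribution *)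

Section extreme_values.
Context {R : realType}.

Lemma cvg_expn_1B (t : R^nat) (l : R) :
  (forall n, 0 <= t n <= 1) -> n%:R * t n @[n --> \oo] --> l ->
  (1 - t n) ^+ n @[n --> \oo] --> expR (- l).
Proof.
move=> t01 tl.
have t0 : t n @[n --> \oo] --> (0 : R).
  rewrite -(mul0r l).
  have H : n.+1%:R^-1 * (n.+1%:R * t n.+1) @[n --> \oo] --> 0 * l.
    apply: cvgM; first exact: cvg_harmonic.
    by rewrite (cvg_shiftS (fun n => n%:R * t n)).
  rewrite -(cvg_shiftS t); apply: cvg_trans H; apply: near_eq_cvg; near=> n.
  by rewrite mulKf// pnatr_eq0.
apply: (@squeeze_cvgr _ _ _ _ (fun n => expR (- (n%:R * t n / (1 - t n))))
  (fun n => expR (- (n%:R * t n)))).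
- near=> n.
  have tn1 : t n < 1.
    by near: n; apply: (cvgr_lt _ t0); exact: ltr01.
  have /andP[tn0 _] := t01 n.
  have u0 : 0 < 1 - t n by rewrite subr_gt0.
  apply/andP; split.
    rewrite -mulrA -mulrN mulrC expRM_natr lerXn2r ?nnegrE ?expR_ge0 ?(ltW u0)//.
    rewrite expRN -[leRHS]invrK lef_pV2 ?posrE ?invr_gt0 ?expR_gt0//.
    apply: le_trans (expR_ge1Dx _).
    rewrite le_eqVlt; apply/orP; left; apply/eqP; field.
    by rewrite gt_eqF.
  rewrite -mulrN mulrC expRM_natr lerXn2r ?nnegrE ?expR_ge0 ?(ltW u0)//.
  exact: expR_ge1Dx.
- apply: (@cvg_comp _ _ _ (fun n => - (n%:R * t n / (1 - t n))) expR);
    last exact: continuous_expR.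
  apply: cvgN; rewrite -[X in _ --> X](divr1 l); apply: cvgM => //.
  apply: cvgV; first exact: oner_neq0.
  by rewrite -[X in _ --> X](subr0 1); apply: cvgB => //; exact: cvg_cst.
- apply: (@cvg_comp _ _ _ (fun n => - (n%:R * t n)) expR);
    last exact: continuous_expR.
  exact: cvgN.
Unshelve. all: by end_near. Qed.

Lemma ln_le_sqrt_sqrt (x : R) : 0 < x -> ln x <= 4 * Num.sqrt (Num.sqrt x).
Proof.
move=> x0; set u := Num.sqrt (Num.sqrt x).
have u0 : 0 < u by rewrite !sqrtr_gt0.
have -> : x = u ^+ 4.
  by rewrite (exprM _ 2 2) !sqr_sqrtr ?sqrtr_ge0// ltW.
rewrite lnXn// -(mulr_natl (ln u)) ler_pM2l//.
rewrite -(subrK 1 u) addrC (le_trans (le_ln1Dx _))//; first by lra.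
by rewrite addrC subrK; lra.
Qed.

Section shifted_tail.
Variables (x : R).

Let L (d : nat) : R := ln d%:R.
Let s d : R := Num.sqrt (2 * L d).
Let w d : R := (ln (L d) - ln (16 / pi) - 2 * x) / (2 * s d).
Let y d : R := s d - w d.

Let cvgL : L d @[d --> \oo] --> +oo.
Proof.
apply: (@cvg_comp _ _ _ (fun d : nat => d%:R : R) (@ln R)).
  exact: cvgr_idn.
apply/cvgryPge => A; near=> t.
have At : expR A <= t by near: t; exact: nbhs_pinfty_ge.
by rewrite -(expRK A) ler_ln ?posrE ?expR_gt0// (lt_le_trans (expR_gt0 A) At).
Unshelve. all: by end_near.
Qed.

Let cvg_sqrty (u : R^nat) : u d @[d --> \oo] --> +oo ->
  Num.sqrt (u d) @[d --> \oo] --> +oo.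
Proof.
move=> /cvgryPge H; apply/cvgryPge => A.
have := H (A ^+ 2); apply: filterS => d /ler_wsqrtr; apply: le_trans.
by rewrite sqrtr_sqr ler_norm.
Qed.

Let cvg2y (u : R^nat) : u d @[d --> \oo] --> +oo -> 2 * u d @[d --> \oo] --> +oo.
Proof.
move=> /cvgryPge H; apply/cvgryPge => A; near=> d.
have : A <= u d by near: d; exact: H.
have : 0 <= u d by near: d; exact: H.
by move=> ? ?; lra.
Unshelve. all: by end_near. Qed.

Let cvgs : s d @[d --> \oo] --> +oo.
Proof. by apply: cvg_sqrty; apply: cvg2y. Qed.

Let cvgVy0 (u : R^nat) : u d @[d --> \oo] --> +oo ->
  (u d)^-1 @[d --> \oo] --> (0 : R).
Proof. by move=> uy; apply/gtr0_cvgV0 => //; move/cvgryPgt : uy; exact. Qed.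

Let cvgw : w d @[d --> \oo] --> (0 : R).
Proof.
pose K : R := ln (16 / pi) + 2 * x.
have cs : (2 * s d)^-1 @[d --> \oo] --> (0 : R).
  by apply: cvgVy0; exact: cvg2y.
have -> : w = (fun d => ln (L d) / (2 * s d) - K * (2 * s d)^-1).
  by apply/funext => d; rewrite /w /K; ring.
rewrite -[X in _ --> X](subr0 0) -[X in _ --> _ - X](mulr0 K).
apply: cvgB; last exact: cvgMr.
apply: (@squeeze_cvgr _ _ _ _ (fun=> 0) (fun d => 2 * (Num.sqrt (Num.sqrt (L d)))^-1)).
- near=> d.
  have L1 : 1 < L d by near: d; move/cvgryPgt : cvgL; exact.
  have L0 : 0 < L d by exact: lt_trans L1.
  have sL : Num.sqrt (L d) <= s d by rewrite ler_wsqrtr// ler_peMl ?ler1n// ltW.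
  have sL0 : 0 < Num.sqrt (L d) by rewrite sqrtr_gt0.
  have ssL0 : 0 < Num.sqrt (Num.sqrt (L d)) by rewrite sqrtr_gt0.
  have s0 : 0 < s d by exact: lt_le_trans sL.
  rewrite divr_ge0 ?ln_ge0 ?mulr_ge0 ?(ltW L1) ?(ltW s0)//=.
  rewrite ler_pdivrMr ?mulr_gt0// (le_trans (ln_le_sqrt_sqrt L0))//.
  have us : Num.sqrt (Num.sqrt (L d)) <= s d / Num.sqrt (Num.sqrt (L d)).
    by rewrite ler_pdivlMr// -expr2 sqr_sqrtr// ltW.
  rewrite [leRHS](_ : _ = 4 * (s d / Num.sqrt (Num.sqrt (L d)))); last by ring.
  by rewrite ler_pM2l.
- exact: cvg_cst.
- rewrite -[X in _ --> X](mulr0 2); apply: cvgMr; apply: cvgVy0.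
  by apply: cvg_sqrty; exact: cvg_sqrty.
Unshelve. all: by end_near. Qed.

Let cvgy : y d @[d --> \oo] --> +oo.
Proof.
apply/cvgryPge => A; near=> d.
have : A + 1 <= s d by near: d; move/cvgryPge : cvgs; exact.
have : w d <= 1 by near: d; apply: (cvgr_le _ cvgw); exact: ltr01.
by rewrite /y; lra.
Unshelve. all: by end_near. Qed.

Lemma phi_shift d : 0 < L d -> 0 < y d ->
  d%:R * (8 * (phi (y d) / y d)) = expR (- x) * expR (- w d ^+ 2 / 2) * (s d / y d).
Proof.
move=> L0 y0.
have d0 : (0 < d%:R :> R).
  rewrite ltr0n lt0n; apply/eqP => d0; move: L0.
  by rewrite /L d0 ln0// ltxx.
have s0 : 0 < s d by rewrite sqrtr_gt0 mulr_gt0.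
have s2 : s d ^+ 2 = 2 * L d by rewrite sqr_sqrtr// ltW// mulr_gt0.
have sw : 2 * s d * w d = ln (L d) - ln (16 / pi) - 2 * x.
  by rewrite /w mulrC divfK// mulf_neq0 ?gt_eqF// pnatr_eq0.
have pi0 : 0 < (pi : R) by exact: pi_gt0.
pose A : R := expR (ln (L d) / 2); pose B : R := expR (- ln (16 / pi) / 2).
have A2 : A ^+ 2 = L d by rewrite -expRM_natr divfK ?lnK// posrE.
have B2 : B ^+ 2 = pi / 16.
  rewrite -expRM_natr divfK// expRN lnK ?invf_div//.
  by rewrite posrE divr_gt0.
have peak2 : (normal_peak 1 : R) ^+ 2 = (2 * pi)^-1.
  rewrite /normal_peak expr1n mul1r exprVn sqr_sqrtr ?mulr_natl//.
  by rewrite mulrn_wge0// ltW.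
have sE : s d = 8 * normal_peak 1 * A * B.
  have p0 : 0 <= 8 * normal_peak 1 * A * B.
    by rewrite !mulr_ge0 ?expR_ge0 ?normal_peak_ge0.
  rewrite -(ger0_norm p0) -sqrtr_sqr /s; congr Num.sqrt.
  rewrite !exprMn A2 B2 peak2; move: pi0; move: (pi : R) => c c0.
  by field; exact: lt0r_neq0.
have yE : - y d ^+ 2 / 2 =
    - L d + ln (L d) / 2 + - ln (16 / pi) / 2 + - x + - w d ^+ 2 / 2.
  have -> : - y d ^+ 2 / 2 = - (s d ^+ 2) / 2 + 2 * s d * w d / 2 + - w d ^+ 2 / 2.
    by rewrite /y; ring.
  by rewrite s2 sw; field.
rewrite /phi yE 4!expRD -/A -/B sE expRN lnK ?posrE//.
field; by rewrite !gt_eqF.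
Qed.

Lemma cvg_phi_shift :
  d%:R * (8 * (phi (y d) / y d)) @[d --> \oo] --> expR (- x).
Proof.
have c0 : - w d ^+ 2 / 2 @[d --> \oo] --> (0 : R).
  rewrite -[X in _ --> X](_ : - (0 * 0) / 2 = 0); last by rewrite mulr0 oppr0 mul0r.
  by apply: cvgMl; apply: cvgN; under eq_fun do rewrite expr2; exact: cvgM.
have ce : expR (- w d ^+ 2 / 2) @[d --> \oo] --> (1 : R).
  rewrite -[X in _ --> X](expR0 R).
  by apply: (cvg_comp _ _ c0); exact: continuous_expR.
have cr : s d / y d @[d --> \oo] --> (1 : R).
  have H : 1 + w d * (y d)^-1 @[d --> \oo] --> (1 + 0 * 0 : R).
    by apply: cvgD; [exact: cvg_cst|apply: cvgM => //; exact: cvgVy0].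
  rewrite mul0r addr0 in H; apply: cvg_trans H; apply: near_eq_cvg; near=> d.
  have y0 : 0 < y d by near: d; move/cvgryPgt : cvgy; exact.
  rewrite -{1}(mulfV (lt0r_neq0 y0)) -mulrDl; congr (_ / _).
  by rewrite /y subrK.
have H : expR (- x) * expR (- w d ^+ 2 / 2) * (s d / y d) @[d --> \oo] -->
    expR (- x) * 1 * 1.
  by apply: cvgM => //; exact: cvgMr.
rewrite !mulr1 in H; apply: cvg_trans H; apply: near_eq_cvg; near=> d.
rewrite phi_shift//.
  by near: d; move/cvgryPgt : cvgL; exact.
by near: d; move/cvgryPgt : cvgy; exact.
Unshelve. all: by end_near. Qed.

Lemma cvg_tail_shift (p : R^nat) :
  (forall d, 0 < s d -> 0 < y d ->
    8 * Phi (- y d) / (1 + 6 * Phi (- y d)) <= p d <= 8 * Phi (- y d)) ->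
  d%:R * p d @[d --> \oo] --> expR (- x).
Proof.
move=> H; have cm := cvg_phi_shift.
have cP : 1 + 6 * Phi (- y d) @[d --> \oo] --> (1 : R).
  rewrite -[X in _ --> X]addr0; apply: cvgD; first exact: cvg_cst.
  rewrite -[X in _ --> X](mulr0 6); apply: cvgMr.
  exact: (@cvg_comp _ _ _ y (fun t => Phi (- t)) _ _ _ cvgy cvg_PhiN).
have cy2 : 1 - y d ^- 2 @[d --> \oo] --> (1 : R).
  rewrite -[X in _ --> X](_ : 1 - 0 * 0 = 1); last by rewrite mulr0 subr0.
  apply: cvgB; first exact: cvg_cst.
  under eq_fun do rewrite -exprVn expr2.
  by apply: cvgM; exact: cvgVy0.
apply: (@squeeze_cvgr _ _ _ _
  (fun d => d%:R * (8 * (phi (y d) / y d)) * (1 - y d ^- 2) / (1 + 6 * Phi (- y d)))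
  (fun d => d%:R * (8 * (phi (y d) / y d)))) => //.
  near=> d.
  have y0 : 0 < y d by near: d; move/cvgryPgt : cvgy; exact.
  have /andP[lo up] : 8 * Phi (- y d) / (1 + 6 * Phi (- y d)) <= p d <= 8 * Phi (- y d).
    apply: H => //; near: d; move/cvgryPgt : cvgs; exact.
  apply/andP; split.
    rewrite -2!mulrA ler_wpM2l// (le_trans _ lo)// mulrA.
    rewrite ler_wpM2r ?invr_ge0 ?addr_ge0 ?mulr_ge0 ?Phi_ge0//.
    by rewrite -mulrA ler_pM2l// Mills_lb.
  by rewrite ler_wpM2l// (le_trans up)// ler_pM2l// Mills_ub.
rewrite -[X in _ --> X](mulr1 (expR (- x))); apply: cvgM; last first.
  by rewrite -[X in _ --> X]invr1; apply: cvgV => //; exact: oner_neq0.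
by rewrite -[X in _ --> X]mulr1; exact: cvgM.
Unshelve. all: by end_near. Qed.

End shifted_tail.

End extreme_values.

Lemma max_rv_le d (T : measurableType d) (R : realType) (P : probability T R)
    (X : nat -> {RV P >-> R}) (r : R) n : iid P X -> (0 < n)%N ->
  P [set w | max_rv X n w <= r] =
    ((1 - fine (distribution P (X 0%N) `]r, +oo[)) ^+ n)%:E.
Proof.
move=> [indX lawX] n0.
have mr : measurable (`]-oo, r] : set R) by exact: measurable_itv.
have mr' : measurable (`]r, +oo[ : set R) by exact: measurable_itv.
have -> : [set w | max_rv X n w <= r] =
    \bigcap_(i in [set i | (0 <= i < n)%N]) (X i @^-1` `]-oo, r]).
  apply/seteqP; split => w /=.
    move=> /bigmax_leP[_ Xr] i /= iltn; rewrite in_itv/=.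
    exact: (Xr (Ordinal iltn)).
  move=> Xr; apply/bigmax_leP; split => [|i _].
    by have := Xr 0%N n0; rewrite /= in_itv.
  by have := Xr i (ltn_ord i); rewrite /= in_itv.
rewrite (mutually_independent_nat indX 0 n (fun=> mr)).
rewrite (eq_bigr (fun=> (1 - fine (distribution P (X 0%N) `]r, +oo[))%:E)) => [|i _].
  by rewrite prodEFin big_const_nat subn0 iter_mulr_1.
have -> : P (X i @^-1` `]-oo, r]) = distribution P (X 0%N) `]-oo, r] by exact: lawX.
by rewrite -setCitvr probability_setC// EFinB fineK// fin_num_measure.
Qed.

Theorem lemmaB1 (R : realType) (q : R) (q_gt0 : 0 < q) (q_le1 : q <= 1)
  (dW : measure_display) (TW : measurableType dW) (PW : probability TW R)
  (W : R -> {RV PW >-> R}) (W_bm : standard_brownian_motion PW W)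
  (dM : measure_display) (TM : measurableType dM) (PM : probability TM R)
  (M : nat -> {RV PM >-> R}) (M_iid : iid PM M)
  (M_law : forall A : set R, measurable A ->
     distribution PM (M 0%N) A =
     PW [set w | A (path_range q (fun t => W t w))]) :
  cvg_in_distribution PM
    (fun d => cst (scale_a q d) \* (max_rv M d \- cst (shift_b q d)) : {RV PM >-> R})
    (@gumbel_cdf R).
Proof.
move=> x _.
pose r (d : nat) : R := shift_b q d + x / scale_a q d.
pose p (d : nat) : R := fine (distribution PM (M 0%N) `]r d, +oo[).
have sq0 : 0 < Num.sqrt q by rewrite sqrtr_gt0.
have mr (z : R) : measurable (`]z, +oo[ : set R) by exact: measurable_itv.
have p01 d : 0 <= p d <= 1.
  apply/andP; split; first exact: fine_ge0.
  rewrite -lee_fin fineK; last by rewrite fin_num_measure.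
  exact: probability_le1.
pose s (d : nat) : R := Num.sqrt (2 * ln d%:R).
pose y (d : nat) : R := s d - (ln (ln d%:R) - ln (16 / pi) - 2 * x) / (2 * s d).
have aE d : scale_a q d = s d / Num.sqrt q.
  by rewrite /scale_a /s mulrC sqrtrM ?invr_ge0 ?ltW// sqrtrV ?ltW// mulrC.
have rE d : 0 < s d -> r d = Num.sqrt q * y d.
  move=> s0; rewrite /r /shift_b aE /y.
  have -> : Num.sqrt (2 * q * ln d%:R) = Num.sqrt q * s d.
    by rewrite -mulrA mulrCA sqrtrM// ltW.
  by rewrite -/(s d); field; rewrite !gt_eqF.
have tail : d%:R * p d @[d --> \oo] --> expR (- x).
  apply: (@cvg_tail_shift R x) => d s0 y0.
  have r0 : 0 <= r d by rewrite rE// mulr_ge0// ltW.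
  have ry : - r d / Num.sqrt q = - y d.
    by rewrite rE// mulNr mulrAC divff ?mul1r// gt_eqF.
  have pE : (p d)%:E = PW (range_gt q W (r d)).
    rewrite fineK ?fin_num_measure// M_law//; congr (PW _).
    by apply/seteqP; split => w /=; rewrite in_itv/= andbT.
  have := range_gt_ub q_gt0 W_bm r0; have := range_gt_lb q_gt0 W_bm r0.
  by rewrite -pE !lee_fin ry -/(y d) => -> ->.
apply: (@cvg_trans _ ((((1 - p d) ^+ d)%:E) @[d --> \oo])); last first.
  by apply: cvg_EFin; [exact: nearW|exact: cvg_expn_1B].
apply: near_eq_cvg; near=> d.
have s0 : 0 < s d.
  rewrite sqrtr_gt0 mulr_gt0// ln_gt0//.
  by near: d; exact: nbhs_infty_gtr.
have d0 : (0 < d)%N by near: d; exact: nbhs_infty_gt.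
have a0 : 0 < scale_a q d by rewrite aE divr_gt0.
rewrite -max_rv_le// /cdf /distribution /pushforward; congr (PM _).
by apply/seteqP; split => w /=;
  rewrite in_itv/= /r (mulrC (scale_a q d)) -ler_pdivlMr// lerBlDl.
Unshelve. all: by end_near. Qed.
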